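(* Let $\mathcal L$ be a finite distributive lattice, $\mathcal I$ a poset ideal and $\mathcal J$ a poset coideal of $\mathcal L$ such that $\mathcal I\cup\mathcal J=\mathcal L$. If $H_{\mathcal I\cap\mathcal J}=H_{\mathcal I}\cap H_{\mathcal J}$, then the following are equivalent: (1) $H_{\mathcal I}\cap H_{\mathcal J}$ has a linear resolution; (2) for each $p\in\mathcal L$, either $p\in\mathcal I$ or $\bigwedge N(p)\in\mathcal J$; (3) for each $r\in\mathcal L$, either $r\in\mathcal J$ or $\bigvee M(r)\in\mathcal I$.
   Context: Let $P$ be the set of join-irreducible elements of $\mathcal L$ (elements with exactly one lower neighbor), with the induced order; for $p\in\mathcal L$ put $\ell(p)=\{q\in P:q\le p\}$. Let $K$ be a field and $S=K[x_p,y_p: p\in P]$ with all variables of degree 1. For $q\in\mathcal L$ put $u_q=\prod_{p\in\ell(q)}x_p\prod_{p\in P\setminus\ell(q)}y_p$, and for $\mathcal S\subseteq\mathcal L$ let $H_{\mathcal S}$ be the ideal generated by $\{u_q:q\in\mathcal S\}$. $N(p)$ is the set of lower neighbors of $p$ (elements covered by $p$), $M(r)$ the set of upper neighbors of $r$ (elements covering $r$); $\bigwedge N(p)$ is the meet of all elements of $N(p)$ and $\bigvee M(r)$ the join of all elements of $M(r)$. Poset ideals are closed downward, poset coideals upward. A graded ideal has a linear resolution if all its minimal generators have the same degree $d$ and in its graded minimal free resolution the $i$-th module is generated in degree $d+i$ for all $i$. *)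

(* Defs.v *)
From HB Require Import structures.
From mathcomp Require Import all_boot all_order all_algebra.
From mathcomp Require Import mpoly.

Set Implicit Arguments.
Unset Strict Implicit.
Unset Printing Implicit Defensive.

Import Order.TTheory GRing.Theory.
Local Open Scope order_scope.

Section Lattice.
Context {disp : Order.disp_t} {L : finTBDistrLatticeType disp}.

Definition covers (p q : L) : bool :=
  (q < p) && [forall r : L, ~~ ((q < r) && (r < p))].

Definition lower_nb (p : L) : {set L} := [set q | covers p q].
Definition upper_nb (r : L) : {set L} := [set s | covers s r].

Definition join_irr (p : L) : bool := #|lower_nb p| == 1%N.
Definition JI : {set L} := [set p | join_irr p].

(* meet of N(p) (top if empty), join of M(r) (bottom if empty) *)
Definition meetN (p : L) : L := \meet_(q in lower_nb p) q.
Definition joinM (r : L) : L := \join_(s in upper_nb r) s.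

Definition poset_ideal (I : {set L}) : Prop :=
  forall x y : L, y \in I -> x <= y -> x \in I.
Definition poset_coideal (J : {set L}) : Prop :=
  forall x y : L, x \in J -> x <= y -> y \in J.

End Lattice.

(* The polynomial ring S = K[x_p, y_p : p in P], P = JI.              *)
(* Variables are numbered: x_p = X_(k), y_p = X_(|P| + k) where k is  *)
(* the position of p in enum P; so S has exactly 2|P| variables.      *)
Section Ring.
Context (K : fieldType) {disp : Order.disp_t} {L : finTBDistrLatticeType disp}.

Definition nvars : nat := (#|@JI _ L| + #|@JI _ L|)%N.
Definition Sring := {mpoly K[nvars]}.

Definition var (k : nat) : Sring :=
  if insub k is Some i then mpolyX K (mnm1 i) else 0%R.

Definition xv (p : L) : Sring := var (index p (enum (@JI _ L))).
Definition yv (p : L) : Sring := var (#|@JI _ L| + index p (enum (@JI _ L))).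

Definition u_mon (q : L) : Sring :=
  ((\prod_(p in @JI _ L | (p <= q)%O) xv p) *
   (\prod_(p in @JI _ L | ~~ (p <= q)%O) yv p))%R.

Definition inH (Sset : {set L}) (f : Sring) : Prop :=
  exists c : L -> Sring, f = (\sum_(q in Sset) c q * u_mon q)%R.

End Ring.
Arguments Sring K {disp} L.

(* Linear resolution of a graded ideal (given as a predicate on the  *)
(* polynomial ring {mpoly K[n]} with all variables of degree 1).     *)
(* A graded free resolution                                           *)
(*   ... -> F_2 -> F_1 -> F_0 -> I -> 0,   F_i = S(-d-i)^(b i)        *)
(* row-vector convention: F_i = 'rV_(b i); the map F_(i+1) -> F_i is *)
(* v |-> v *m D i, whose entries are forms of degree 1 (degree-0 maps *)
(* between S(-d-i-1) and S(-d-i)); F_0 -> I is v |-> v *m g with the *)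
(* entries of g forms of degree d.  Such a resolution is necessarily  *)
(* minimal, so its existence says precisely that the graded minimal   *)
(* free resolution has i-th module generated in degree d+i.           *)
Local Open Scope ring_scope.
Definition has_linear_resolution (K : fieldType) (n : nat)
    (I : {mpoly K[n]} -> Prop) : Prop :=
  exists (d : nat) (b : nat -> nat)
         (g : 'cV[{mpoly K[n]}]_(b 0%N))
         (D : forall i : nat, 'M[{mpoly K[n]}]_(b i.+1, b i)),
    [/\ (forall j, g j 0 \is d.-homog),
        (forall i j k, D i j k \is 1%N.-homog),
        (forall f, I f <-> exists v : 'rV_(b 0%N), f = (v *m g) 0 0),
        (forall v : 'rV_(b 0%N), v *m g = 0 <-> exists w, v = w *m D 0%N) &
        (forall i (v : 'rV_(b i.+1)), v *m D i = 0 <-> exists w, v = w *m D i.+1)].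

(* Main.v *)
(** Identify [L] with the lattice of down-sets of [P]. For a family [F] of
    down-sets, let [C(F)] be the complex of free modules with one generator for
    each cube [a, a + A] (a Boolean interval) contained in [F], the face maps
    being multiplied by the variables [x_j] (lower the top) and [- y_j] (raise
    the bottom); all its matrices are linear.

    If [F] is an ideal of [L], then [C(F)] resolves [H_F]: removing a maximal
    element [b] from [F] splits off the Koszul complex on the [y_j] with [j]
    maximal in [b]. By complementation the same holds for coideals. If every cube
    of [L] lies in [I] or in [J], which is what each of (2) and (3) says, then
    Mayer-Vietoris shows that [C(I :&: J)] resolves [H_(I :&: J)] linearly.

    Conversely, let [p \notin I] and [meetN p \notin J], and let [a] be maximal
    in [[meetN p, p]] with [a \notin J]. Let [E] be the Koszul chain
    [u_a * e_T], where [T] is the set of the [x_j] with [j] below [p] and not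
    below [a]. Its boundary has coefficients in [H_(I :&: J)], one degree above
    the generators, so a linear resolution would make it the boundary of a chain
    with coefficients in [H_(I :&: J)]; comparing coefficients along a chain from
    [a] to [p] shows that this is impossible. *)

Require Import Defs.
From HB Require Import structures.
From mathcomp Require Import all_boot all_order all_algebra.
From mathcomp Require Import mpoly.

Set Implicit Arguments.
Unset Strict Implicit.
Unset Printing Implicit Defensive.

Import Order.TTheory GRing.Theory.
Local Open Scope ring_scope.

(** * Coefficients of products with a monomial *)

Section MonomialMultiples.
Variables (K : fieldType) (n : nat).
Implicit Types (p : {mpoly K[n]}) (m : 'X_{1..n}).

Lemma mcoeffMXE p m m' :
  (p * 'X_[m])@_m' = if (m <= m')%MM then p@_(m' - m) else 0.
Proof.
case: ifP => [le_mm'|nle].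
  by rewrite -{1}(submK le_mm') addmC mcoeffMX.
rewrite {1}(mpolyE p) mulr_suml raddf_sum /= big1 // => m1 _.
rewrite -scalerAl mcoeffZ -mpolyXD mcoeffX.
case: eqP => [E|]; last by rewrite mulr0.
by move: nle; rewrite -E lem_addl.
Qed.

Lemma lem1E i m : (U_(i) <= m)%MM = (0 < m i)%N.
Proof.
apply/mnm_lepP/idP => [/(_ i)|m_gt0 j]; rewrite mnm1E ?eqxx //.
by case: eqP => [<-|].
Qed.

Lemma mcoeffXUM p i m :
  ('X_i * p)@_m = if (0 < m i)%N then p@_(m - U_(i)) else 0.
Proof. by rewrite mulrC mcoeffMXE lem1E. Qed.

End MonomialMultiples.

(** * Signs of the exterior algebra *)

Section Sign.
Variables (R : comNzRingType) (k : nat).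
Implicit Types (A : {set 'I_k}) (i j : 'I_k).

(** The sign of sorting [e_j] followed by the wedge of [A]. *)
Definition sg j A : R := (-1) ^+ #|[set i in A | (i < j)%N]|.

Lemma sgU1 i j A : j \notin A -> sg i (j |: A) = (-1) ^+ (j < i)%N * sg i A.
Proof.
move=> jA; rewrite /sg -exprD; congr (_ ^+ _).
case: (ltnP j i) => ji.
  have -> : [set l in j |: A | (l < i)%N] = j |: [set l in A | (l < i)%N].
    by apply/setP=> l; rewrite !inE andb_orl; case: eqP => // ->; rewrite ji.
  by rewrite cardsU1 !inE (negbTE jA).
have -> // : [set l in j |: A | (l < i)%N] = [set l in A | (l < i)%N].
by apply/setP=> l; rewrite !inE andb_orl; case: eqP => // ->; rewrite ltnNge ji andbF.
Qed.

(** Both products sort the same wedge, up to the swap of [e_i] and [e_j]. *)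
Lemma sg_anticomm i j A : i != j -> i \notin A -> j \notin A ->
  sg i A * sg j (i |: A) = - (sg j A * sg i (j |: A)).
Proof.
move=> ij iA jA; rewrite !sgU1 //.
case: (ltngtP i j) => [| |/val_inj E]; last by rewrite E eqxx in ij.
  by rewrite expr1 expr0 mul1r mulN1r mulrN mulrC.
by rewrite expr1 expr0 mul1r mulN1r mulrN opprK mulrC.
Qed.

Lemma sg_min j A : {in A, forall i : 'I_k, (j <= i)%N} -> sg j A = 1.
Proof.
move=> jA; rewrite /sg (_ : [set i in A | (i < j)%N] = set0) ?cards0 ?expr0 //.
apply/setP=> i; rewrite !inE; apply/negP => /andP[/jA].
by rewrite leqNgt => /negP.
Qed.

(** The diagonal is a separate hypothesis because antisymmetry only gives [F i i + F i i = 0]. *)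
Lemma sum_anticomm (V : zmodType) (F : 'I_k -> 'I_k -> V) :
  (forall i, F i i = 0) -> (forall i j, F i j = - F j i) ->
  \sum_i \sum_j F i j = 0.
Proof.
move=> F0 FN.
have split i : \sum_j F i j =
    \sum_(j : 'I_k | (i < j)%N) F i j + \sum_(j : 'I_k | (j < i)%N) F i j.
  rewrite (bigID (fun j : 'I_k => (i < j)%N)) /=; congr (_ + _).
  rewrite (bigD1 i) /= ?ltnn // F0 add0r; apply: eq_bigl => j.
  by rewrite -leqNgt ltn_neqAle andbC.
under eq_bigr do rewrite split.
rewrite big_split /= [X in _ + X](exchange_big_dep predT) //=.
rewrite -big_split big1 //= => i _.
by rewrite -big_split big1 //= => j _; rewrite FN addNr.
Qed.

End Sign.

(** * Differentials with square zero *)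

Section Boundary.
Variables (R : comNzRingType) (k : nat) (X : Type).
Variables (t : 'I_k -> X -> X) (c : X -> 'I_k -> R).
Hypothesis tC : forall i j x, t i (t j x) = t j (t i x).
Hypothesis ct : forall i j x, i != j -> c (t j x) i = c x i.

(* Common form of the Koszul differential ([X := unit]) and of the cellular
   differential of a cube complex ([x : X] is then the bottom vertex). *)
Definition bdry (z : X -> {set 'I_k} -> R) (x : X) (A : {set 'I_k}) : R :=
  \sum_(j | j \notin A) sg R j A * c x j * z (t j x) (j |: A).

(** Inserting [i] and [j] in either order gives the same coefficient by [tC] and [ct], with opposite
    signs by [sg_anticomm]. *)
Lemma bdry_bdry z x A : bdry (bdry z) x A = 0.
Proof.
pose F i j := if [&& i != j, i \notin A & j \notin A] then
  sg R i A * c x i * (sg R j (i |: A) * c x j * z (t j (t i x)) (j |: (i |: A)))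
  else 0.
transitivity (\sum_i \sum_j F i j).
  rewrite /bdry big_mkcond /=; apply: eq_bigr => i _.
  rewrite mulr_sumr big_mkcond /=.
  case: ifPn => iA.
    apply: eq_bigr => j _; rewrite /F !inE negb_or iA /= eq_sym.
    by case: ifPn => // /andP[ij _]; rewrite ct // eq_sym.
  by rewrite big1 // => j _; rewrite /F (negbTE iA) /= andbF.
apply: sum_anticomm => [i|i j]; first by rewrite /F eqxx.
rewrite /F eq_sym [(i \notin A) && _]andbC.
case: ifPn => [/and3P[ij jA iA]|]; last by rewrite oppr0.
rewrite tC setUCA !mulrA -![_ * c x _ * sg _ _ _]mulrAC.
rewrite [sg R i A * _]sg_anticomm ?(eq_sym i) //.
by rewrite !mulNr [X in - (X * _)]mulrAC.
Qed.

Lemma bdryD z z' x A :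
  bdry (fun y B => z y B + z' y B) x A = bdry z x A + bdry z' x A.
Proof. by rewrite /bdry -big_split; apply: eq_bigr => j _; rewrite mulrDr. Qed.

Lemma bdryN z x A : bdry (fun y B => - z y B) x A = - bdry z x A.
Proof. by rewrite /bdry -sumrN; apply: eq_bigr => j _; rewrite mulrN. Qed.

Lemma eq_bdry z z' : z =2 z' -> bdry z =2 bdry z'.
Proof. by move=> E x A; apply: eq_bigr => j _; rewrite E. Qed.

End Boundary.

(** * Exactness of Koszul complexes *)

Section Koszul.
Variables (K : fieldType) (k n : nat) (v : 'I_k -> 'I_n).
Hypothesis v_inj : injective v.
Local Notation S := {mpoly K[n]}.
Implicit Types (z w : {set 'I_k} -> S) (m : 'X_{1..n}) (M A : {set 'I_k}).

Definition koszul z A : S :=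
  \sum_(j | j \notin A) sg S j A * 'X_(v j) * z (j |: A).

Lemma mcoeff_sg j A (p : S) m : (sg S j A * p)@_m = sg K j A * p@_m.
Proof.
rewrite /sg -[in LHS]signr_odd -[in RHS]signr_odd.
by case: (odd _); rewrite ?expr0 ?expr1 ?mul1r // !mulN1r mcoeffN.
Qed.

Lemma mcoeff_koszul z A m : (koszul z A)@_m =
  \sum_(j | (j \notin A) && (0 < m (v j))%N)
     sg K j A * (z (j |: A))@_(m - U_(v j)).
Proof.
rewrite /koszul raddf_sum [RHS]big_mkcondr; apply: eq_bigr => j _ /=.
by rewrite -mulrA mcoeff_sg mcoeffXUM; case: ifP => // _; rewrite mulr0.
Qed.

Lemma koszul_koszul z A : koszul (koszul z) A = 0.
Proof.
pose t (j : 'I_k) (x : unit) := x; pose c (_ : unit) j : S := 'X_(v j).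
exact: (@bdry_bdry _ _ _ t c _ _ (fun _ => z) tt A).
Qed.

Lemma koszulB z w A : koszul (fun B => z B - w B) A = koszul z A - koszul w A.
Proof.
by rewrite /koszul -sumrB; apply: eq_bigr => j _; rewrite mulrBr.
Qed.

(* The classical homotopy: divide by the first variable of [M] that occurs in
   the monomial, and put it in front of the exterior part, provided it precedes
   the whole exterior part. *)
Definition khom_cond M (j : 'I_k) m :=
  [forall i : 'I_k, (i \in M) && (i < j)%N ==> (m (v i) == 0)%N].

Definition khom M z A : S :=
  if A \subset M then
    if [pick j in A | [forall i in A, (j <= i)%N]] is Some j then
      \sum_(m <- msupp (z (A :\ j)) | (0 < m (v j))%N && khom_cond M j m)
         (z (A :\ j))@_m *: 'X_[m - U_(v j)]
    else 0
  else 0.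

Lemma mcoeff_khom M z A j m : A \subset M -> j \in A ->
    {in A, forall i : 'I_k, (j <= i)%N} ->
  (khom M z A)@_m =
    if khom_cond M j m then (z (A :\ j))@_(m + U_(v j)) else 0.
Proof.
move=> AM jA jmin; rewrite /khom AM.
case: pickP => [j' /andP[j'A /forall_inP j'min]|/(_ j)]; last first.
  by rewrite jA /= => /negP[]; apply/forall_inP.
have {j' j'A j'min}-> : j' = j.
  by apply/val_inj/anti_leq; rewrite /= jmin // j'min.
set p := z (A :\ j).
have condD : khom_cond M j (m + U_(v j)) = khom_cond M j m.
  apply: eq_forallb => i; rewrite mnmDE mnm1E (inj_eq v_inj).
  by case: (j =P i) => [->|_]; rewrite ?ltnn ?andbF // addn0.
rewrite raddf_sum /=.
transitivity (\sum_(m' <- msupp p | m' == (m + U_(v j))%MM)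
   (if khom_cond M j m then p@_m' else 0)).
  rewrite big_mkcond [RHS]big_mkcond /=; apply: eq_bigr => m' _.
  rewrite mcoeffZ mcoeffX; case: (m' =P _) => [->|ne].
    by rewrite mnmDE mnm1E eqxx addn1 condD /= addmK eqxx mulr1.
  case: ifP => // /andP[m'_gt0 _]; case: eqP => [E|_]; last by rewrite mulr0.
  by case: ne; rewrite -E submK // lem1E.
case: (boolP ((m + U_(v j))%MM \in msupp p)) => [msp|msp].
  rewrite big_mkcond (bigD1_seq (m + U_(v j))%MM) ?msupp_uniq //= eqxx.
  by rewrite big1 ?addr0 // => m' /negbTE->.
rewrite big_seq_cond big1 ?(memN_msupp_eq0 msp) ?if_same //.
by move=> m' /andP[m'p /eqP E]; move: msp; rewrite -E m'p.
Qed.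

Lemma khom_cond_sub M j m i : khom_cond M j m -> khom_cond M j (m - U_(v i)).
Proof.
move/forallP=> h; apply/forallP=> l; apply/implyP=> lM.
by have /implyP/(_ lM)/eqP E := h l; rewrite mnmBE E sub0n.
Qed.

(** [khom M] is a contracting homotopy except in exterior degree 0 on monomials free of the
    variables of [M], which the last hypothesis excludes. *)
Theorem koszul_exact M z :
    (forall A, ~~ (A \subset M) -> z A = 0) ->
    (forall A, koszul z A = 0) ->
    (forall m, {in M, forall j, m (v j) = 0%N} -> (z set0)@_m = 0) ->
  exists w, [/\ forall A, ~~ (A \subset M) -> w A = 0,
    forall d, (forall A, #|A| != d -> z A = 0) ->
              forall A, #|A| != d.+1 -> w A = 0 &
    forall A, koszul w A = z A].
Proof.
move=> zM zcyc z0; exists (khom M z); split=> [A|d zd A Ad|A].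
- by rewrite /khom => /negbTE->.
- rewrite /khom; case: ifP => // _; case: pickP => // j /andP[jA _].
  by rewrite zd ?msupp0 ?big_nil //; move: Ad; rewrite (cardsD1 j) jA.
case: (boolP (A \subset M)) => AM; last first.
  rewrite zM // /koszul big1 // => j jA.
  by rewrite /khom subUset (negbTE AM) andbF mulr0.
apply/mpolyP=> m; rewrite mcoeff_koszul.
(* The smallest index of [B] decides which term yields the coefficient of [m] at [A]. *)
pose B := A :|: [set j in M | (0 < m (v j))%N].
have [B0|[i0 i0B]] := set_0Vmem B.
  have [A0 M0] : A = set0 /\ [set j in M | (0 < m (v j))%N] = set0.
    by split; apply/eqP; rewrite -subset0 -B0 ?subsetUl ?subsetUr.
  have mM0 : {in M, forall j, m (v j) = 0%N}.
    move=> j jM; apply/eqP; rewrite -leqn0 leqNgt; apply/negP => mj.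
    by have := in_set0 j; rewrite -M0 inE jM mj.
  rewrite A0 z0 // big1 // => j /andP[_ mj].
  case: (boolP (j \in M)) => jM; first by rewrite mM0 in mj.
  by rewrite /khom subUset sub1set (negbTE jM) /= mcoeff0 mulr0.
case: (@arg_minnP _ i0 (mem B) val i0B) => j0 /= j0B j0min.
have condj0 : khom_cond M j0 m.
  apply/forallP=> i; apply/implyP=> /andP[iM ij0].
  rewrite -leqn0 leqNgt; apply/negP => mi.
  have /j0min : i \in B by rewrite !inE iM mi orbT.
  by rewrite leqNgt ij0.
(* If it lies in [A], the cycle condition at [A :\ j0], read at [m] times the variable of [j0],
   expresses [z A] by the terms of the sum. *)
case: (boolP (j0 \in A)) => j0A.
  have Amin : {in A, forall i : 'I_k, (j0 <= i)%N}.
    by move=> i iA; apply: j0min; rewrite !inE iA.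
  have := congr1 (mcoeff (m + U_(v j0))) (zcyc (A :\ j0)).
  rewrite mcoeff_koszul mcoeff0 (bigD1 j0) /=; last first.
    by rewrite !inE eqxx /= mnmDE mnm1E eqxx addn1.
  rewrite addmK setD1K // sg_min ?mul1r; last first.
    by move=> i; rewrite !inE => /andP[_ /Amin].
  move/eqP; rewrite addr_eq0 => /eqP->.
  rewrite -sumrN [LHS](bigID (mem M)) /= [X in _ + X]big1 ?addr0; last first.
    move=> j /andP[/andP[jA mj] jM].
    by rewrite /khom subUset sub1set (negbTE jM) /= mcoeff0 mulr0.
  rewrite [RHS](bigID (mem M)) /= [X in _ + X]big1 ?addr0; last first.
    move=> j /andP[_ jM].
    by rewrite zM ?mcoeff0 ?mulr0 ?oppr0 // subUset sub1set (negbTE jM).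
  apply: eq_big => j.
    rewrite !inE negb_and negbK mnmDE mnm1E (inj_eq v_inj) [j0 == j]eq_sym.
    by case: (j =P j0) => [->|_] /=; rewrite ?j0A ?andbF ?addn0 ?andbT.
  case/andP=> /andP[jA mj] jM.
  have jj0 : j0 != j by apply: contraNneq jA => <-.
  have lj : (j0 < j)%N.
    by rewrite ltn_neqAle jj0 j0min // !inE jM mj orbT.
  rewrite (@mcoeff_khom _ _ _ j0) ?subUset ?sub1set ?jM //=; first last.
  - by move=> i; rewrite !inE => /predU1P[->|/Amin//]; apply: ltnW.
  - by rewrite !inE j0A orbT.
  rewrite khom_cond_sub // -{1}(setD1K j0A) sgU1 ?setD11 // lj expr1 mulN1r mulNr.
  congr (- (_ * _)).
  have -> : (j |: A) :\ j0 = j |: A :\ j0.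
    apply/setP=> i; rewrite !inE; case: (i =P j) => [->|] /=; last by [].
    by rewrite eq_sym jj0.
  congr (_ @_ _); apply/mnmP=> i; rewrite !(mnmDE, mnmBE, mnm1E).
  by case: (v j =P i) => [<-|_]; rewrite ?subn0 // (inj_eq v_inj) (negbTE jj0) !addn0.
have /andP[j0M mj0] : (j0 \in M) && (0 < m (v j0))%N.
  by move: j0B; rewrite !inE (negbTE j0A).
have Amin : {in A, forall i : 'I_k, (j0 <= i)%N}.
  by move=> i iA; apply: j0min; rewrite !inE iA.
(* Otherwise the term of [j0] is the whole coefficient: for [j != j0] the variable of [j0] still
   occurs and precedes [j |: A], so [khom] has no coefficient there. *)
rewrite (bigD1 j0) ?j0A //= (@mcoeff_khom _ _ _ j0) ?subUset ?sub1set ?j0M //=;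
  first last.
- by move=> i; rewrite !inE => /predU1P[->|/Amin].
- by rewrite !inE eqxx.
rewrite khom_cond_sub // setU1K // submK ?lem1E // sg_min // mul1r.
rewrite big1 ?addr0 // => j /andP[/andP[jA mj] jj0].
case: (boolP (j \in M)) => jM; last first.
  by rewrite /khom subUset sub1set (negbTE jM) /= mcoeff0 mulr0.
case: (@arg_minnP _ j (mem (j |: A)) val (setU11 _ _)) => l /= lA lmin.
have lj0 : (j0 < l)%N.
  rewrite ltn_neqAle; move: lA; rewrite !inE => /predU1P[->|lA].
    by rewrite eq_sym jj0 j0min // !inE jM mj orbT.
  by rewrite Amin // andbT; apply: contraNneq j0A => /val_inj->.
rewrite (@mcoeff_khom _ _ _ l) ?subUset ?sub1set ?jM //.
case: ifP => [/forallP/(_ j0)|]; last by rewrite mulr0.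
by rewrite j0M lj0 mnmBE mnm1E (inj_eq v_inj) (negbTE jj0) subn0 -leqn0 leqNgt mj0.
Qed.

End Koszul.

(** * The cube complex of a family of sets *)

Section CubeComplex.
Variables (K : fieldType) (k : nat).
Local Notation V := 'I_k.
Local Notation N := (k + k)%N.
Local Notation S := {mpoly K[N]}.
Implicit Types (s : bool) (a b A B : {set V}) (F G : {set {set V}}) (m : 'X_{1..N}).

(* For [s = true] the variables [x_j], [y_j] are [vx true j], [vx false j];
   [s = false] exchanges the roles of the [x_j] and the [y_j], which is what
   passing to complements (the dual lattice) amounts to. *)
Definition vx s (j : V) : 'I_N := if s then lshift k j else rshift k j.


Lemma vx_eq s t i j : (vx s i == vx t j) = (s == t) && (i == j).
Proof.
by rewrite /vx; case: s; case: t;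
  rewrite ?eq_lshift ?eq_rshift ?eq_lrshift ?eq_rlshift.
Qed.

Lemma vx_inj s : injective (vx s).
Proof. by move=> i j /eqP; rewrite vx_eq eqxx => /eqP. Qed.

Lemma vxP (i : 'I_N) : exists t j, i = vx t j.
Proof. by case: (split_ordP i) => j ->; [exists true|exists false]; exists j. Qed.

(** For [s = true], the exponents of the generator [u_a]. *)
Definition um s a : 'X_{1..N} :=
  [multinom (match split i with
             | inl j => (j \in a) == s
             | inr j => (j \in a) == ~~ s
             end : nat) | i < N].

Lemma umE s a t j : um s a (vx t j) = ((j \in a) == (s == t)) :> nat.
Proof.
rewrite mnmE /vx; case: t; rewrite ?(unsplitK (inl j)) ?(unsplitK (inr j)).
  by case: s.
by case: s.
Qed.

Lemma umC s a : um (~~ s) (~: a) = um s a.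
Proof.
apply/mnmP=> i; have [t [j ->]] := vxP i; rewrite !umE inE.
by case: (j \in a); case: s; case: t.
Qed.

Lemma um_inj s : injective (um s).
Proof.
move=> a b /mnmP E; apply/setP=> j; have := E (vx s j).
by rewrite !umE eqxx; case: (j \in a); case: (j \in b).
Qed.

(** For [i != j] each side contains exactly one of [x_i], [y_i], so divisibility forces the same
    choice. *)
Lemma um_le_add s a b t j : (um s a <= um s b + U_(vx t j))%MM ->
  forall i, i != j -> (i \in a) = (i \in b).
Proof.
move/mnm_lepP=> le i ij; have := le (vx s i); have := le (vx (~~ s) i).
rewrite !mnmDE !umE !mnm1E !vx_eq ![j == i]eq_sym (negbTE ij) !andbF !addn0.
by rewrite eqxx; case: s {le}; case: (i \in a); case: (i \in b).
Qed.

Lemma um_le s a b : (um s a <= um s b)%MM -> a = b.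
Proof.
move/mnm_lepP=> le; apply/setP=> i.
have := le (vx s i); have := le (vx (~~ s) i); rewrite !umE eqxx.
by case: s {le}; case: (i \in a); case: (i \in b).
Qed.

(** For [s = true], the linear syzygy [x_j u_a = y_j u_(j |: a)] along an edge. *)
Lemma um_addx s a j : j \notin a ->
  (um s a + U_(vx s j) = um s (j |: a) + U_(vx (~~ s) j))%MM.
Proof.
move=> ja; apply/mnmP=> l; have [t [i ->]] := vxP l.
rewrite !mnmDE !umE !mnm1E !vx_eq !inE [i == j]eq_sym.
case: (j =P i) => [<-|_] /=; last by rewrite !andbF.
by rewrite (negbTE ja); case: s; case: t.
Qed.

Lemma mdeg_um s a : mdeg (um s a) = k.
Proof.
rewrite mdegE big_split_ord /= -[RHS]card_ord -sum1_card -big_split /=.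
apply: eq_bigr => j _; have := umE s a true j; have := umE s a false j.
by rewrite /vx => -> ->; case: (j \in a); case: s.
Qed.

Definition cf s a j : S := if j \in a then - 'X_(vx (~~ s) j) else 'X_(vx s j).

Lemma cfD1 s i j a : i != j -> cf s (a :\ j) i = cf s a i.
Proof. by move=> ij; rewrite /cf !inE ij. Qed.

(** In each direction [j \notin A], the pair [(a :\ j, j |: A)] is the only cube having [(a, A)] as
    a facet: the upper facet if [j \in a], the lower one otherwise. *)
Definition cbdry s := bdry (fun j a => a :\ j) (cf s).

Lemma cbdryE s z a A : cbdry s z a A =
  \sum_(j | j \notin A) sg S j A * cf s a j * z (a :\ j) (j |: A).
Proof. by []. Qed.

Lemma cbdry_cbdry s z a A : cbdry s (cbdry s z) a A = 0.
Proof.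
by apply: bdry_bdry => [i j x|]; [rewrite !setDDl setUC|exact: cfD1].
Qed.

(* [(a, A)] stands for the face of the cube [{set V}] with vertices [a :|: B],
   for [B \subset A]. *)
Definition cell F a A :=
  [disjoint a & A] && [forall B : {set V}, (B \subset A) ==> (a :|: B \in F)].

Lemma cellP F a A : reflect
  ([disjoint a & A] /\ forall B, B \subset A -> a :|: B \in F) (cell F a A).
Proof.
apply: (iffP andP) => -[aA H]; split => //.
  by move=> B; move/forallP/(_ B)/implyP: H; apply.
by apply/forallP=> B; apply/implyP; apply: H.
Qed.

Lemma cell_bot F a A : cell F a A -> a \in F.
Proof. by case/cellP=> _ /(_ set0 (sub0set _)); rewrite setU0. Qed.

Lemma cell_top F a A : cell F a A -> a :|: A \in F.
Proof. by case/cellP=> _; apply. Qed.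

Lemma cell0 F a : cell F a set0 = (a \in F).
Proof.
apply/idP/idP => [/cell_bot //|aF]; apply/cellP; split.
  by rewrite disjoint_sym disjoints_subset sub0set.
by move=> B; rewrite subset0 => /eqP->; rewrite setU0.
Qed.

Lemma cellI F G a A : cell (F :&: G) a A = cell F a A && cell G a A.
Proof.
apply/cellP/andP => [[aA H]|[/cellP[aA HF] /cellP[_ HG]]].
  by split; apply/cellP; split=> // B /H; rewrite inE => /andP[].
by split=> // B BA; rewrite inE HF ?HG.
Qed.

Lemma cell_face F a A j :
  j \notin A -> cell F (a :\ j) (j |: A) -> cell F a A.
Proof.
move=> jA /cellP[dis H]; apply/cellP; split.
  apply/pred0P => i /=; apply/negP => /andP[ia iA].
  have ij : i != j by apply: contraNneq jA => <-.
  by have /pred0P/(_ i) /= := dis; rewrite !inE ia iA ij orbT.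
move=> B BA; case: (boolP (j \in a)) => ja.
  have -> : a :|: B = (a :\ j) :|: (j |: B) by rewrite setUCA setUA setD1K.
  by apply: H; apply: setUS.
have -> : a = a :\ j.
  by apply/setP=> i; rewrite !inE; case: (i =P j) => // ->; rewrite (negbTE ja).
by apply: H; apply: subset_trans BA (subsetUr _ _).
Qed.

Definition chain F i (z : {set V} -> {set V} -> S) :=
  forall a A, ~~ (cell F a A && (#|A| == i)) -> z a A = 0.

Lemma chain_cbdry s F i z : chain F i.+1 z -> chain F i (cbdry s z).
Proof.
move=> zF a A naA; rewrite cbdryE big1 // => j jA; rewrite zF ?mulr0 //.
apply: contra naA => /andP[/(cell_face jA)-> /=].
by rewrite cardsU1 jA.
Qed.

Lemma chainD F i z z' : chain F i z -> chain F i z' ->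
  chain F i (fun a A => z a A + z' a A).
Proof. by move=> zF z'F a A naA; rewrite zF // z'F // addr0. Qed.

Lemma chainN F i z : chain F i z -> chain F i (fun a A => - z a A).
Proof. by move=> zF a A naA; rewrite zF // oppr0. Qed.

Lemma sub_chain F G i z : F \subset G -> chain F i z -> chain G i z.
Proof.
move=> /subsetP FG zF a A naA; apply: zF; apply: contra naA => /andP[/cellP[dis H] ->].
by rewrite andbT; apply/cellP; split=> // B /H/FG.
Qed.

Lemma chainI F G i z : chain F i z -> chain G i z -> chain (F :&: G) i z.
Proof.
move=> zF zG a A; rewrite cellI; case: (boolP (cell F a A)) => [_|nF _] /=.
  by move=> nG; apply: zG.
by rewrite zF // (negbTE nF).
Qed.

Definition aug s (z : {set V} -> {set V} -> S) : S :=
  \sum_a z a set0 * 'X_[um s a].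

Lemma augD s z z' : aug s (fun a A => z a A + z' a A) = aug s z + aug s z'.
Proof. by rewrite /aug -big_split; apply: eq_bigr => a _; rewrite mulrDl. Qed.

Lemma augN s z : aug s (fun a A => - z a A) = - aug s z.
Proof. by rewrite /aug -sumrN; apply: eq_bigr => a _; rewrite mulNr. Qed.

Lemma eq_aug s z z' : z =2 z' -> aug s z = aug s z'.
Proof. by move=> E; apply: eq_bigr => a _; rewrite E. Qed.

(** An edge contributes only at its endpoints [a] and [j |: a], where the two terms cancel by
    [um_addx]. *)
Lemma aug_cbdry s z : aug s (cbdry s z) = 0.
Proof.
transitivity (\sum_a \sum_j
    sg S j set0 * cf s a j * z (a :\ j) (j |: set0) * 'X_[um s a]).
  apply: eq_bigr => a _; rewrite cbdryE mulr_suml.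
  by apply: eq_bigl => j; rewrite inE.
rewrite exchange_big big1 //= => j _.
rewrite (bigID (fun a => j \in a)) /=.
rewrite (reindex_onto (fun a : {set V} => j |: a) (fun a => a :\ j)) /=; last first.
  by move=> a; apply: setD1K.
rewrite (eq_bigl (fun a => j \notin a)); last first.
  move=> a; rewrite !inE eqxx /=; apply/eqP/idP => [<-|/setU1K //].
  by rewrite !inE eqxx.
rewrite -big_split big1 //= => a ja.
have aj : a :\ j = a.
  by apply/setP=> i; rewrite !inE; case: (i =P j) => // ->; rewrite (negbTE ja).
rewrite setU1K // aj setU0 /cf !inE eqxx (negbTE ja) /=.
rewrite -!mulrA -mulrDr ![_ * (z a _ * _)]mulrCA -mulrDr mulNr -!mpolyXD.
by rewrite ![(U_(_) + _)%MM]addmC (um_addx s ja) addNr !mulr0.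
Qed.

(** Induction removing a vertex [b] of maximal size. For [s = true], the closure conditions make the
    colon ideal of the other generators by [u_b] the ideal of the [y_j] with [j] in [M]. *)
Theorem cube_exact s F :
    {in F &, forall a b, a :&: b \in F} ->
    {in F &, forall q b : {set V},
       q \proper b -> exists2 j, j \in b :\: q & b :\ j \in F} ->
  forall i z, chain F i z -> (forall a A, cbdry s z a A = 0) -> aug s z = 0 ->
  exists2 w, chain F i.+1 w & cbdry s w =2 z.
Proof.
elim: {F}_.+1 {-2}F (ltnSn #|F|) => // n IH F Fn FI Fprop i z zF zcyc zaug.
have [F0|[b0 b0F]] := set_0Vmem F.
  exists (fun _ _ => 0) => [//|a A]; rewrite zF.
    by rewrite cbdryE big1 // => j _; rewrite mulr0.
  by apply/negP => /andP[/cell_bot]; rewrite F0 inE.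
case: (@arg_maxnP _ b0 (mem F) (fun b => #|b|) b0F) => b /= bF bmax.
have {}bmax a : a \in F -> b \subset a -> a = b.
  by move=> aF ba; apply/esym/eqP; rewrite eqEcard ba bmax.
pose M := [set j in b | b :\ j \in F].
have Mb : M \subset b by apply/subsetP=> j; rewrite inE => /andP[].
(* The part of [z] on the cells with top [b]. *)
pose zb A := z (b :\: A) A.
have zbM A : ~~ (A \subset M) -> zb A = 0.
  move=> nAM; apply: zF; apply: contra nAM => /andP[cA _].
  have Ab : A \subset b.
    rewrite -(bmax _ (cell_top cA)) ?subsetUr //.
    by apply/subsetP=> l lb; rewrite !inE lb andbT orNb.
  apply/subsetP=> j jA; rewrite inE (subsetP Ab) //=.
  have /cellP[_ /(_ (A :\ j))] := cA; rewrite subsetDl => /(_ isT).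
  congr (_ \in F); apply/setP=> l; rewrite !inE.
  case: (l =P j) => [->|_] /=; first by rewrite jA.
  by case: (boolP (l \in A)) => [/(subsetP Ab)->|] //=; rewrite orbF.
(* On cells with top [b] the boundary is minus the Koszul differential in the variables that raise
   the bottom. *)
have step (w : {set V} -> S) A : (forall B, ~~ (B \subset M) -> w B = 0) ->
    \sum_(j | j \notin A) sg S j A * cf s (b :\: A) j * w (j |: A)
    = - koszul (vx (~~ s)) w A.
  move=> wM; rewrite -sumrN; apply: eq_bigr => j jA; rewrite /cf !inE jA /=.
  case: ifPn => jb; first by rewrite mulrN mulNr.
  rewrite wM ?mulr0 ?oppr0 // subUset sub1set negb_and inE (negbTE jb) //.
have zbcyc A : koszul (vx (~~ s)) zb A = 0.
  apply: oppr_inj; rewrite oppr0 -step // -[RHS](zcyc (b :\: A) A).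
  by apply: eq_bigr => j jA; rewrite setDDl [A :|: _]setUC.
(* If [m] has no variable from [M], no generator of another vertex of [F] divides [u_b] times [m],
   so only [z b set0] contributes to this coefficient of [aug s z]. *)
have zb0 m : {in M, forall j, m (vx (~~ s) j) = 0%N} -> (zb set0)@_m = 0.
  move=> mM; have := congr1 (mcoeff (um s b + m)) zaug.
  rewrite mcoeff0 /aug raddf_sum (bigD1 b) //= mcoeffMX /zb setD0.
  rewrite big1 ?addr0 // => a ab; rewrite mcoeffMXE.
  case: ifP => // /mnm_lepP le; case: (boolP (a \in F)) => aF; last first.
    by rewrite zF ?mcoeff0 // cell0 (negbTE aF).
  have /Fprop : a :&: b \in F by apply: FI.
  case/(_ b bF) => [|j].
    rewrite properEneq subsetIr andbT; apply: contraNneq ab => E.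
    by apply/eqP/bmax => //; rewrite -E subsetIl.
  rewrite !inE negb_and => /andP[nj jb] bj; rewrite jb orbF in nj.
  have /mM mj : j \in M by rewrite inE jb.
  have := le (vx (~~ s) j); rewrite mnmDE !umE mj (negbTE nj) jb.
  by case: (s).
have [wb [wbM wbd wbz]] := koszul_exact (@vx_inj _) zbM zbcyc zb0.
have cellM A : A \subset M -> cell F (b :\: A) A.
  move=> AM; apply/cellP; split.
    rewrite -setI_eq0; apply/eqP/setP=> l; rewrite !inE.
    by case: (l \in A); rewrite ?andbF.
  (* [b :\: C] is the intersection of the [b :\ j] with [j] in [C]. *)
  have bM (C : {set V}) : C \subset M -> b :\: C \in F.
    elim: {C}_.+1 {-2}C (ltnSn #|C|) => // c IHc C Cc CM.
    have [->|[j jC]] := set_0Vmem C; first by rewrite setD0.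
    rewrite -(setD1K jC) -setDDl.
    have -> : b :\ j :\: (C :\ j) = (b :\ j) :&: (b :\: (C :\ j)).
      by apply/setP=> l; rewrite !inE; case: (l \in b); rewrite ?andbF ?andbT // andbC.
    apply: FI; first by have := subsetP CM j jC; rewrite inE => /andP[].
    apply: IHc; last by apply: subset_trans CM; apply: subsetDl.
    by move: Cc; rewrite (cardsD1 j C) jC ltnS.
  move=> B BA; have -> : b :\: A :|: B = b :\: (A :\: B).
    apply/setP=> l; rewrite !inE; case: (boolP (l \in B)) => lB; rewrite ?orbT ?orbF //=.
    by rewrite (subsetP Mb) // (subsetP AM) // (subsetP BA).
  by apply: bM; apply: subset_trans AM; apply: subsetDl.
(* The minus sign offsets the one in [step]: subtracting the boundary of [w1] clears the cells with
   top [b]. *)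
pose w1 a A := if a == b :\: A then - wb A else 0.
have w1F : chain F i.+1 w1.
  move=> a A naA; rewrite /w1; case: (a =P _) naA => // -> naA.
  case: (boolP (A \subset M)) => AM; last by rewrite wbM ?oppr0.
  rewrite (wbd i) ?oppr0 //; last by move: naA; rewrite cellM.
  by move=> B Bi; rewrite /zb zF // negb_and Bi orbT.
pose z' a A := z a A + - cbdry s w1 a A.
have z'F : chain F i z' by apply: chainD => //; apply: chainN; apply: chain_cbdry.
have z'b A : z' (b :\: A) A = 0.
  rewrite /z' cbdryE.
  have -> : \sum_(j | j \notin A)
      sg S j A * cf s (b :\: A) j * w1 ((b :\: A) :\ j) (j |: A)
    = - \sum_(j | j \notin A) sg S j A * cf s (b :\: A) j * wb (j |: A).
    rewrite -sumrN; apply: eq_bigr => j jA.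
    by rewrite /w1 setDDl [A :|: _]setUC eqxx mulrN.
  by rewrite step // opprK wbz /zb subrr.
(* By maximality, a cell of [F] containing [b] has it as top, and [z'] vanishes there. *)
have z'F' : chain (F :\ b) i z'.
  move=> a A naA; case: (boolP (cell F a A && (#|A| == i))) => [/andP[c Ai]|/z'F//].
  have dis : [disjoint a & A] by case/cellP: c.
  have /eqP abA : a == b :\: A.
    apply: contraNT naA => ne; rewrite Ai andbT; apply/cellP; split=> // B BA.
    rewrite !inE; have /cellP[_ /(_ _ BA) ->] := c; rewrite andbT.
    apply: contraNneq ne => E.
    have -> : b = a :|: A.
      by rewrite -(bmax _ (cell_top c)) // -E setUS.
    rewrite setDUl setDv setU0 eq_sym; apply/eqP/setDidPl.
    exact: dis.
  by rewrite abA z'b.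
have [|||a A||w2 w2F w2z] := IH (F :\ b) _ _ _ i z' z'F'.
- by move: Fn; rewrite (cardsD1 b F) bF.
- move=> p q; rewrite !inE => /andP[pb pF] /andP[qb qF]; rewrite FI // andbT.
  apply: contraNneq pb => E; apply/eqP; apply: bmax => //.
  by rewrite -E subsetIl.
- move=> q p; rewrite !inE => /andP[qb qF] /andP[pb pF] /(Fprop _ _ qF pF)[j jpq pj].
  exists j => //; rewrite inE pj andbT !inE; apply: contraNneq pb => E.
  by apply/eqP; apply: bmax => //; rewrite -E subsetDl.
- rewrite /z' /cbdry bdryD bdryN -!/(cbdry s _ _ _) zcyc.
  by rewrite cbdry_cbdry oppr0 addr0.
- by rewrite /z' augD augN zaug aug_cbdry subr0.
exists (fun a A => w1 a A + w2 a A).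
  by apply: chainD => //; apply: sub_chain w2F; apply: subsetDl.
by move=> a A; rewrite /cbdry bdryD -!/(cbdry s _ _ _) w2z /z' addrC addrNK.
Qed.

End CubeComplex.

(** * Complementation, Mayer-Vietoris and the resolution *)

Section CubeResolution.
Variables (K : fieldType) (k : nat).
Local Notation V := 'I_k.
Local Notation N := (k + k)%N.
Local Notation S := {mpoly K[N]}.
Implicit Types (s : bool) (a b A B : {set V}) (F G : {set {set V}}).
Implicit Types (z w : {set V} -> {set V} -> S).

Definition cofam F : {set {set V}} := (@setC V) @^-1: F.

Lemma cofamK : involutive cofam.
Proof. by move=> F; apply/setP=> a; rewrite !inE setCK. Qed.

Lemma setC_cellK a A : [disjoint a & A] -> ~: (~: (a :|: A) :|: A) = a.
Proof.
move=> dis; apply/setP=> l; rewrite !inE negb_or negbK.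
have /pred0P/(_ l) /= := dis; by case: (l \in a); case: (l \in A).
Qed.

Lemma disjoint_setCU a A : [disjoint ~: (a :|: A) & A].
Proof. by apply/pred0P => l; rewrite /= !inE; case: (l \in A); rewrite ?orbT ?andbF. Qed.

Lemma cell_cofam F a A : cell F a A -> cell (cofam F) (~: (a :|: A)) A.
Proof.
case/cellP=> dis H; apply/cellP; split; first exact: disjoint_setCU.
move=> B BA; rewrite inE.
have -> : ~: (~: (a :|: A) :|: B) = a :|: (A :\: B).
  apply/setP=> l; rewrite !inE negb_or negbK.
  case: (boolP (l \in B)) => lB; rewrite ?andbF ?andbT //= orbF.
  by have /pred0P/(_ l) /= := dis; rewrite (subsetP BA) // andbT => ->.
by apply: H; apply: subsetDl.
Qed.

(** Complementing the vertices of a cube keeps its directions. The guard makes this an involution on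
    chains: if [a] meets [A], then [~: (a :|: A)] does not determine [a]. *)
Definition dualz z a A : S :=
  if [disjoint a & A] then z (~: (a :|: A)) A else 0.

Lemma chain_dualz F i z : chain F i z -> chain (cofam F) i (dualz z).
Proof.
move=> zF a A naA; rewrite /dualz; case: ifP => // dis; apply: zF.
apply: contra naA => /andP[/cell_cofam c ->]; rewrite andbT.
by rewrite setC_cellK in c.
Qed.

Lemma dualzK F i z : chain F i z -> dualz (dualz z) =2 z.
Proof.
move=> zF a A; rewrite /dualz; case: ifPn => dis.
  by rewrite disjoint_setCU setC_cellK.
by rewrite zF // /cell (negbTE dis).
Qed.

(** Complementation exchanges the two facets in each direction, which changes the sign of [cf] and
    leaves [sg] alone. *)
Lemma cbdry_dualz s z a A : cbdry (~~ s) (dualz z) a A = - dualz (cbdry s z) a A.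
Proof.
rewrite /dualz; case: ifPn => dis; rewrite cbdryE; last first.
  rewrite big1 ?oppr0 // => j jA; case: ifPn => [dis'|]; last by rewrite mulr0.
  case/negP: dis; apply/pred0P => l; have /pred0P/(_ l) /= := dis'; rewrite !inE.
  case: (l =P j) => [->|_] //= _; by rewrite (negbTE jA) andbF.
rewrite cbdryE -sumrN; apply: eq_bigr => j jA.
have -> : [disjoint a :\ j & j |: A].
  apply/pred0P => l; have /pred0P/(_ l) /= := dis; rewrite !inE.
  by case: (l =P j).
have -> : ~: (a :\ j :|: (j |: A)) = ~: (a :|: A) :\ j.
  by apply/setP=> l; rewrite !inE; case: (l =P j); rewrite ?orbT.
rewrite -mulNr; congr (_ * _); rewrite -mulrN; congr (_ * _).
rewrite /cf !inE (negbTE jA) orbF negbK.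
by case: (j \in a); rewrite ?opprK.
Qed.

Lemma aug_dualz s z : aug (~~ s) (dualz z) = aug s z.
Proof.
rewrite /aug (reindex_inj (@setC_inj V)); apply: eq_bigr => a _.
rewrite /dualz umC; congr (_ * _).
by rewrite disjoint_sym disjoints_subset sub0set setU0 setCK.
Qed.

Theorem cocube_exact s F :
    {in F &, forall a b, a :|: b \in F} ->
    {in F &, forall q b : {set V},
       q \proper b -> exists2 j, j \in b :\: q & j |: q \in F} ->
  forall i z, chain F i z -> (forall a A, cbdry s z a A = 0) -> aug s z = 0 ->
  exists2 w, chain F i.+1 w & cbdry s w =2 z.
Proof.
move=> FU Fprop i z zF zcyc zaug.
have := @cube_exact K k (~~ s) (cofam F) _ _ i (dualz z) (chain_dualz zF).
case=> [a b|q b|a A||w wF wz].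
- by rewrite !inE => aF bF; rewrite setCI FU.
- rewrite !inE => qF bF qb.
  have [|j] := Fprop _ _ bF qF; first by rewrite properC.
  rewrite !inE negbK => /andP[jb jq] F1; exists j; rewrite !inE ?jb ?jq //.
  congr (_ \in F): F1; apply/setP=> l; rewrite !inE negb_and negbK //.
- by rewrite cbdry_dualz /dualz zcyc if_same oppr0.
- by rewrite aug_dualz.
exists (fun a A => - dualz w a A).
  by apply: chainN; rewrite -[F]cofamK; apply: chain_dualz.
move=> a A; rewrite /cbdry bdryN -/(cbdry s _ a A) -[s]negbK cbdry_dualz opprK.
by rewrite /dualz wz -/(dualz (dualz z) a A) (dualzK zF).
Qed.

(* Mayer-Vietoris for [0 -> C(F :&: G) -> C(F) (+) C(G) -> C(F :|: G) -> 0]. *)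
Theorem capcube_exact s F G :
    (forall a A, cell (F :|: G) a A -> cell F a A || cell G a A) ->
    {in F :|: G &, forall a b, a :&: b \in F :|: G} ->
    {in F :|: G &, forall q b : {set V},
       q \proper b -> exists2 j, j \in b :\: q & b :\ j \in F :|: G} ->
    {in F &, forall a b, a :&: b \in F} ->
    {in F &, forall q b : {set V},
       q \proper b -> exists2 j, j \in b :\: q & b :\ j \in F} ->
    {in G &, forall a b, a :|: b \in G} ->
    {in G &, forall q b : {set V},
       q \proper b -> exists2 j, j \in b :\: q & j |: q \in G} ->
  forall i z, chain (F :&: G) i z -> (forall a A, cbdry s z a A = 0) ->
    aug s z = 0 ->
  exists2 w, chain (F :&: G) i.+1 w & cbdry s w =2 z.
Proof.
move=> FGcell FGI FGprop FI Fprop GU Gprop i z zFG zcyc zaug.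
have [wF wFc wFz] := cube_exact FI Fprop (sub_chain (subsetIl F G) zFG) zcyc zaug.
have [wG wGc wGz] := cocube_exact GU Gprop (sub_chain (subsetIr F G) zFG) zcyc zaug.
(* The two fillings differ by a cycle of positive dimension, which bounds in the union. *)
pose u a A := wF a A + - wG a A.
have uc : chain (F :|: G) i.+1 u.
  apply: chainD; last apply: chainN.
    by apply: sub_chain wFc; apply: subsetUl.
  by apply: sub_chain wGc; apply: subsetUr.
have ucyc a A : cbdry s u a A = 0.
  by rewrite /cbdry bdryD bdryN -!/(cbdry s _ _ _) wFz wGz subrr.
have uaug : aug s u = 0.
  rewrite /aug big1 // => a _; rewrite uc ?mul0r //.
  by rewrite cards0 andbF.
have [v vc vu] := cube_exact FGI FGprop uc ucyc uaug.
(* By [FGcell], the cells of [v] outside [F] lie in [G]. *)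
pose vF a A := if cell F a A then v a A else 0.
pose vG a A := if cell F a A then 0 else v a A.
have vE a A : v a A = vF a A + vG a A.
  by rewrite /vF /vG; case: ifP; rewrite ?addr0 ?add0r.
have vFc : chain F i.+2 vF.
  move=> a A naA; rewrite /vF; case: ifP naA => //= cF naA; apply: vc.
  by rewrite negb_and naA orbT.
have vGc : chain G i.+2 vG.
  move=> a A naA; rewrite /vG; case: ifPn => // ncF; apply: vc.
  apply: contra naA => /andP[/FGcell]; rewrite (negbTE ncF) /= => -> -> //.
(* This chain also equals [wG] plus the boundary of [vG], so it lives on both families. *)
exists (fun a A => wF a A + - cbdry s vF a A).
  apply: chainI.
    by apply: chainD => //; apply/chainN/chain_cbdry.
  have wE a A : wF a A + - cbdry s vF a A = wG a A + cbdry s vG a A.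
    have := vu a A; rewrite /cbdry (eq_bdry _ _ vE) bdryD -!/(cbdry s _ _ _) => E.
    apply/eqP; rewrite subr_eq -addrA [cbdry s vG _ _ + _]addrC E.
    by rewrite /u addrC subrK.
  by move=> a A naA; rewrite wE; exact: (chainD wGc (@chain_cbdry _ _ s _ _ _ vGc)) naA.
move=> a A; rewrite /cbdry bdryD bdryN -!/(cbdry s _ _ _) wFz.
by rewrite cbdry_cbdry subr0.
Qed.

(** * Matrices of the cube complex *)

Section Matrices.
Variable F : {set {set V}}.

Definition cells i : {set {set V} * {set V}} :=
  [set c | cell F c.1 c.2 && (#|c.2| == i)].

Lemma cellsE i a A : ((a, A) \in cells i) = cell F a A && (#|A| == i).
Proof. by rewrite inE. Qed.

Definition zrow i z : 'rV[S]_(#|cells i|) :=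
  \row_r z (enum_val r).1 (enum_val r).2.

Definition rowz i (v : 'rV[S]_(#|cells i|)) a A : S :=
  \sum_r v 0 r * (enum_val r == (a, A))%:R.

Lemma chain_rowz i v : chain F i (@rowz i v).
Proof.
move=> a A; rewrite -cellsE => naA; rewrite /rowz big1 // => r _.
case: eqP => [E|]; last by rewrite mulr0.
by move: naA; rewrite -E enum_valP.
Qed.

Lemma rowzK i : cancel (@rowz i) (zrow i).
Proof.
move=> v; apply/rowP=> r; rewrite mxE /rowz (bigD1 r) //= -surjective_pairing.
rewrite eqxx mulr1 big1 ?addr0 // => r' ne.
by rewrite (inj_eq enum_val_inj) (negbTE ne) mulr0.
Qed.

Lemma zrowK i z : chain F i z -> rowz (zrow i z) =2 z.
Proof.
move=> zF a A; case: (boolP ((a, A) \in cells i)) => c; last first.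
  by rewrite chain_rowz -?cellsE // zF -?cellsE.
rewrite /rowz (bigD1 (enum_rank_in c (a, A))) //= mxE enum_rankK_in //= eqxx mulr1.
rewrite big1 ?addr0 // => r ne; case: eqP => [E|]; last by rewrite mulr0.
by case/eqP: ne; apply: enum_val_inj; rewrite enum_rankK_in.
Qed.

Definition cmat i : 'M[S]_(#|cells i.+1|, #|cells i|) :=
  \matrix_(r < #|cells i.+1|, t < #|cells i|) \sum_(j | j \notin (enum_val t).2)
    (enum_val r == ((enum_val t).1 :\ j, j |: (enum_val t).2))%:R *
    (sg S j (enum_val t).2 * cf K true (enum_val t).1 j).

Definition gmat : 'cV[S]_(#|cells 0|) := \col_r 'X_[um true (enum_val r).1].

Lemma mul_cmat i v : v *m cmat i = zrow i (cbdry true (rowz v)).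
Proof.
apply/rowP=> t; rewrite !mxE cbdryE.
under eq_bigr do rewrite mxE mulr_sumr.
rewrite exchange_big; apply: eq_bigr => j _; rewrite /rowz mulr_sumr.
by apply: eq_bigr => r _; rewrite [LHS]mulrA [LHS]mulrC.
Qed.

Lemma mul_gmat v : (v *m gmat) 0 0 = aug true (rowz v).
Proof.
rewrite mxE /aug; under [RHS]eq_bigr do rewrite /rowz mulr_suml.
rewrite exchange_big; apply: eq_bigr => r _ /=; rewrite mxE.
have Er : enum_val r = ((enum_val r).1, set0).
  rewrite [LHS]surjective_pairing; congr pair.
  by have := enum_valP r; rewrite inE => /andP[_]; rewrite cards_eq0 => /eqP.
rewrite (bigD1 (enum_val r).1) //= {2}Er eqxx mulr1 big1 ?addr0 // => a ne.
case: eqP => [E|]; last by rewrite mulr0 mul0r.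
by case/eqP: ne; rewrite E.
Qed.

Definition inHF (f : S) :=
  exists c : {set V} -> S, f = \sum_(a in F) c a * 'X_[um true a].

Theorem cube_linear_resolution :
    (forall i z, chain F i z -> (forall a A, cbdry true z a A = 0) ->
       aug true z = 0 -> exists2 w, chain F i.+1 w & cbdry true w =2 z) ->
  has_linear_resolution inHF.
Proof.
(* [k] is the degree of every [u_a]. *)
move=> exF; exists k, (fun i => #|cells i|), gmat, cmat.
have zrow_ext i z z' : z =2 z' -> zrow i z = zrow i z'.
  by move=> E; apply/rowP=> r; rewrite !mxE E.
have zrow0 i : zrow i (fun _ _ => 0) = 0 by apply/rowP=> r; rewrite !mxE.
have rowz0 i a A : rowz (0 : 'rV[S]_(#|cells i|)) a A = 0.
  by rewrite /rowz big1 // => r _; rewrite mxE mul0r.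
have bdK i (v : 'rV[S]_(#|cells i.+1|)) : rowz (v *m cmat i) =2 cbdry true (rowz v).
  move=> a A; rewrite mul_cmat zrowK //; apply: chain_cbdry; exact: chain_rowz.
(* This serves all degrees: the boundary condition is automatic on 0-chains, the augmentation
   condition on the others. *)
have cycle_bd i (v : 'rV_(#|cells i|)) : (forall a A, cbdry true (rowz v) a A = 0) ->
    aug true (rowz v) = 0 -> exists u, v = u *m cmat i.
  move=> vcyc vaug; have [w wF wv] := exF _ _ (chain_rowz v) vcyc vaug.
  exists (zrow _ w); rewrite mul_cmat -[LHS]rowzK; apply: zrow_ext => a A.
  by rewrite -wv; apply: eq_bdry => b B; rewrite zrowK.
split.
- by move=> j; rewrite mxE dhomogX /= mdeg_um.
- move=> i r t; rewrite mxE; apply: rpred_sum => j _.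
  case: (_ == _); last by rewrite mul0r rpred0.
  rewrite mul1r /sg -signr_odd mulr_sign /cf.
  have hX l : ('X_l : S) \is 1.-homog by rewrite dhomogX /= mdeg1.
  by do 2!case: ifP => _; rewrite ?rpredN.
- move=> f; split=> [[c ->]|[v ->]].
    pose z a A := if (a \in F) && (A == set0) then c a else 0.
    have zF : chain F 0 z.
      move=> a A naA; rewrite /z; case: ifP => // /andP[aF /eqP A0].
      by move: naA; rewrite A0 cell0 aF cards0.
    exists (zrow 0 z); rewrite mul_gmat (eq_aug true (zrowK zF)) /aug big_mkcond /=.
    by apply: eq_bigr => a _; rewrite /z eqxx andbT; case: ifP; rewrite ?mul0r.
  exists (rowz v ^~ set0); rewrite mul_gmat /aug [RHS]big_mkcond /=.
  apply: eq_bigr => a _; case: ifPn => // aF.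
  by rewrite chain_rowz ?mul0r // cell0 (negbTE aF).
- move=> v; split=> [v0|[w ->]].
    apply: cycle_bd => [a A|]; last by rewrite -mul_gmat v0 mxE.
    rewrite cbdryE big1 // => j jA; rewrite chain_rowz ?mulr0 //.
    by rewrite cardsU1 jA andbF.
  apply/matrixP=> r t; rewrite !ord1 mul_gmat mxE.
  by rewrite (eq_aug true (bdK _ w)) aug_cbdry.
move=> i v; split=> [v0|[w ->]].
  apply: cycle_bd => [a A|].
    by rewrite -bdK v0 rowz0.
  rewrite /aug big1 // => a _; rewrite chain_rowz ?mul0r //.
  by rewrite cards0 andbF.
rewrite mul_cmat -[RHS](zrow0 i); apply: zrow_ext => a A.
rewrite /cbdry (eq_bdry _ _ (bdK _ w)); exact: cbdry_cbdry.
Qed.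

End Matrices.

End CubeResolution.

(** * Koszul cycles and linear resolutions *)

Section KoszulHomology.
Variables (K : fieldType) (n : nat).
Local Notation S := {mpoly K[n]}.
Implicit Types (A B : {set 'I_n}) (m : 'X_{1..n}).

(** All monomials of [q] have degree [e], so a nonconstant term of [p] leads beyond the degree of
    [m]. *)
Lemma mcoeff_homogM (p q : S) e m : q \is e.-homog -> (mdeg m <= e)%N ->
  (p * q)@_m = p@_0 * q@_m.
Proof.
move=> qe me; rewrite {1 2}(mpolyE q) mulr_sumr !raddf_sum mulr_sumr big_seq.
rewrite [RHS]big_seq; apply: eq_bigr => m' m'q.
rewrite /= -scalerAr !mcoeffZ mcoeffMXE mcoeffX mulrCA; congr (_ * _).
case: (m' =P m) => [->|ne].
  have -> : (m - m = 0)%MM by apply/mnmP=> i; rewrite mnmBE subnn mnm0E.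
  by rewrite mulr1; case: ifP => // /mnm_lepP[].
rewrite mulr0; case: ifP => // le; case: ne.
have := submK le; rewrite addmC => E.
have : mdeg (m - m') = 0%N.
  have := congr1 mdeg E; rewrite mdegD (dhomog_mf qe m'q) => E'.
  by apply/eqP; rewrite -leqn0 -(leq_add2l e) E' addn0.
by move/eqP; rewrite mdeg_eq0 => /eqP E0; rewrite -E E0 addm0.
Qed.

(** The degree [e] part of [v *m M] comes from the constant terms of [v]. As it vanishes, [M] kills
    these constants and they can be subtracted. *)
Lemma lift_const_free r c (M : 'M[S]_(r, c)) e (v : 'rV_r) :
    (forall i j, M i j \is e.-homog) ->
    (forall i m, mdeg m = e -> ((v *m M) 0 i)@_m = 0) ->
  exists v', v' *m M = v *m M /\ forall i, (v' 0 i)@_0 = 0.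
Proof.
move=> Me vM; pose v0 : 'rV[S]_r := \row_i ((v 0 i)@_0)%:MP.
exists (v - v0); split=> [|i]; last first.
  by rewrite !mxE mcoeffB mcoeffC eqxx mulr1 subrr.
rewrite mulmxBl; suff -> : v0 *m M = 0 by rewrite subr0.
apply/rowP=> i; rewrite [RHS]mxE; apply/mpolyP=> m; rewrite mcoeff0.
case: (mdeg m =P e) => me.
  rewrite -(vM i m me) !mxE !raddf_sum; apply: eq_bigr => j _.
  by rewrite /= mxE !(mcoeff_homogM _ (Me _ _)) ?me // mcoeffC eqxx mulr1.
rewrite mxE raddf_sum big1 //= => j _.
by rewrite mxE mcoeffCM (dhomog_nemf_coeff (Me _ _)) ?mulr0 //; apply/eqP.
Qed.

Local Notation kos := (@koszul K n n id).

Definition koszulr b (z : {set 'I_n} -> 'rV[S]_b) A : 'rV[S]_b :=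
  \row_i kos (fun B => z B 0 i) A.

Lemma koszulrE b (z : {set 'I_n} -> 'rV[S]_b) A :
  koszulr z A = \sum_(j | j \notin A) (sg S j A * 'X_j) *: z (j |: A).
Proof.
by apply/rowP=> i; rewrite mxE summxE; apply: eq_bigr => j _; rewrite !mxE.
Qed.

Lemma koszulr_mulmx b c (M : 'M[S]_(b, c)) z A :
  koszulr (fun B => z B *m M) A = koszulr z A *m M.
Proof.
rewrite !koszulrE mulmx_suml; apply: eq_bigr => j _; exact: scalemxAl.
Qed.

Lemma koszulrB b (z w : {set 'I_n} -> 'rV[S]_b) A :
  koszulr (fun B => z B - w B) A = koszulr z A - koszulr w A.
Proof.
by rewrite !koszulrE -sumrB; apply: eq_bigr => j _; rewrite scalerBr.
Qed.

Lemma eq_koszulr b (z w : {set 'I_n} -> 'rV[S]_b) :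
  z =1 w -> koszulr z =1 koszulr w.
Proof. by move=> E A; rewrite !koszulrE; apply: eq_bigr => j _; rewrite E. Qed.

Lemma koszulr_koszulr b (z : {set 'I_n} -> 'rV[S]_b) A : koszulr (koszulr z) A = 0.
Proof.
apply/rowP=> i; rewrite !mxE -[RHS](koszul_koszul id (fun B => z B 0 i) A).
by apply: eq_bigr => j _; rewrite mxE.
Qed.

Lemma koszulr_exact b d (z : {set 'I_n} -> 'rV[S]_b) :
    (forall A, #|A| != d -> z A = 0) -> (forall A, koszulr z A = 0) ->
    (forall i, (z set0 0 i)@_0 = 0) ->
  exists2 w : {set 'I_n} -> 'rV[S]_b,
    forall A, #|A| != d.+1 -> w A = 0 & forall A, koszulr w A = z A.
Proof.
move=> zd zcyc z0.
have /fin_all_exists[w wP] : forall i : 'I_b, exists w : {set 'I_n} -> S,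
    (forall A, #|A| != d.+1 -> w A = 0) /\ (forall A, kos w A = z A 0 i).
  move=> i; have [|||w [_ wd wz]] :=
      @koszul_exact K n n id (@inj_id _) setT (fun A => z A 0 i).
  - by move=> A; rewrite subsetT.
  - by move=> A; move/rowP/(_ i): (zcyc A); rewrite !mxE.
  - move=> m m0; suff -> : m = 0%MM by [].
    by apply/mnmP=> j; rewrite m0 ?inE // mnm0E.
  exists w; split=> // A; apply: wd => B Bd.
  by rewrite zd // mxE.
exists (fun A => \row_i w i A) => A => [Ad|]; apply/rowP=> i; rewrite !mxE.
  by have [-> //] := wP i.
by have [_ <-] := wP i; apply: eq_bigr => j _; rewrite mxE.
Qed.

(* In a linear resolution, Koszul cycles of the resolved module that lie one
   degree above the linear strand are boundaries; the cycle is pushed along the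
   resolution until its exterior degree is 0. *)
Lemma koszul_linear i : forall (b : nat -> nat)
    (D : forall l, 'M[S]_(b l.+1, b l)) c (M : 'M[S]_(b 0%N, c)),
    (forall l p q, D l p q \is 1.-homog) ->
    (forall v : 'rV_(b 0%N), v *m M = 0 <-> exists w, v = w *m D 0%N) ->
    (forall l (v : 'rV_(b l.+1)), v *m D l = 0 <-> exists w, v = w *m D l.+1) ->
  forall v : {set 'I_n} -> 'rV[S]_(b 0%N),
    (forall A, #|A| != i -> v A = 0) ->
    (forall A l, (v A 0 l)@_0 = 0) ->
    (forall A, koszulr (fun B => v B *m M) A = 0) ->
  exists2 y : {set 'I_n} -> 'rV[S]_(b 0%N),
    forall A, #|A| != i.+1 -> y A = 0 &
    forall A, koszulr (fun B => y B *m M) A = v A *m M.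
Proof.
elim: i => [|i IH] b D c M Dlin Mex Dex v vi v0 vcyc.
  have [A|y yd yv] := koszulr_exact vi _ (v0 set0).
    rewrite koszulrE big1 // => j jA; rewrite vi ?scaler0 //.
    by rewrite cardsU1 jA.
  by exists y => // A; rewrite koszulr_mulmx yv.
(* [M] kills the Koszul boundary of [v], which therefore lifts through [D 0]; having no linear
   terms, it has a lift without constant terms. *)
have /fin_all_exists[v' v'P] : forall A, exists v' : 'rV[S]_(b 1%N),
    [/\ #|A| != i -> v' = 0, forall l, (v' 0 l)@_0 = 0 & koszulr v A = v' *m D 0%N].
  move=> A; case: (boolP (#|A| == i)) => Ai; last first.
    exists 0; split=> // [l|]; first by rewrite mxE mcoeff0.
    rewrite mul0mx koszulrE big1 // => j jA; rewrite vi ?scaler0 //.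
    by rewrite cardsU1 jA eqSS.
  have /Mex[w wE] : koszulr v A *m M = 0 by rewrite -koszulr_mulmx vcyc.
  have [l m m1|w' [w'E w'0]] := lift_const_free (v := w) (Dlin 0%N).
    rewrite -wE mxE mcoeff_koszul big1 // => j /andP[_ mj].
    suff -> : (m - U_(j) = 0)%MM by rewrite v0 mulr0.
    apply/eqP; rewrite -mdeg_eq0 -(eqn_add2r (mdeg U_(j))) -mdegD submK ?lem1E //.
    by rewrite m1 mdeg1.
  by exists w'; split; rewrite ?Ai // w'E.
(* The induction moves to the next syzygy module, with [D 0] in place of [M]. *)
have [|||||A|y' y'd y'v] := IH (fun l => b l.+1) (fun l => D l.+1) _ (D 0%N) _ _ _ v'.
- by move=> l p q; apply: Dlin.
- exact: Dex.
- by move=> l; apply: Dex.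
- by move=> A; case: (v'P A).
- by move=> A; case: (v'P A).
- rewrite -[RHS](koszulr_koszulr v A); apply: eq_koszulr => B.
  by case: (v'P B).
(* Subtracting [y' A *m D 0] turns [v] into a Koszul cycle with the same image under [M]. *)
have [A Ai|A|l|y yd yv] :=
    @koszulr_exact _ i.+1 (fun A => v A - y' A *m D 0%N).
- by rewrite vi // y'd // mul0mx subr0.
- by rewrite koszulrB y'v; case: (v'P A) => _ _ ->; rewrite subrr.
- by rewrite vi ?cards0 // y'd ?cards0 // mul0mx subr0 mxE mcoeff0.
exists y => // A; rewrite koszulr_mulmx yv mulmxBl.
suff -> : y' A *m D 0%N *m M = 0 by rewrite subr0.
by apply/Mex; exists (y' A).
Qed.

End KoszulHomology.

(** * An obstruction to linear resolutions *)

Section Obstruction.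
Arguments vx : simpl never.
Variables (K : fieldType) (k : nat).
Local Notation V := 'I_k.
Local Notation N := (k + k)%N.
Local Notation S := {mpoly K[N]}.
Implicit Types (a b q : {set V}) (m : 'X_{1..N}) (f : S).
Variable F : {set {set V}}.

Lemma inHF_gen a (p : S) : a \in F -> inHF F (p * 'X_[um true a]).
Proof.
move=> aF; exists (fun q => if q == a then p else 0).
by rewrite (bigD1 a) //= eqxx big1 ?addr0 // => q /andP[_ /negbTE->]; rewrite mul0r.
Qed.

Lemma inHF_sum (I : finType) (P : pred I) (f : I -> S) :
  (forall i, P i -> inHF F (f i)) -> inHF F (\sum_(i | P i) f i).
Proof.
move=> Pf; apply: big_ind => // [|_ _ [c ->] [c' ->]].
  by exists (fun _ => 0); rewrite big1 // => a _; rewrite mul0r.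
exists (fun a => c a + c' a); rewrite -big_split.
by apply: eq_bigr => a _; rewrite mulrDl.
Qed.

Lemma inHF_coeff f m : inHF F f -> {in F, forall a, ~~ (um true a <= m)%MM} ->
  f@_m = 0.
Proof.
case=> c -> mF; rewrite raddf_sum big1 //= => a aF.
by rewrite mcoeffMXE (negbTE (mF a aF)).
Qed.

(* Over the multidegree of [x_b y_(~: a)] the Koszul complex of the ideal is the
   complex of cochains of the cube [a, b] vanishing on vertices outside [F]; the
   coboundary of the indicator function of [a] is a cocycle which could only be
   the coboundary of a function equal to 0 at [a] and at [b]. *)
Theorem linear_resolution_obstruction a b :
    has_linear_resolution (inHF (K := K) F) -> a \proper b -> a \notin F -> b \notin F ->
  ~ {in b :\: a, forall j, j |: a \in F}.
Proof.
case=> d [bt [g [D [gd Dlin Hg gex Dex]]]] ab aF bF ajF.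
(* For [q] between [a] and [b], [u_q] times the variables in [W q] is [x_b y_(~: a)]: the terms
   [u_q e_(W q)] share one multidegree. *)
pose W q : {set 'I_N} :=
  vx true @: (b :\: q) :|: vx false @: (q :\: a).
have WE t j q : (vx t j \in W q) = if t then j \in b :\: q else j \in q :\: a.
  rewrite inE; case: t.
    rewrite mem_imset; last exact: vx_inj.
    rewrite [X in _ || X](_ : _ = false) ?orbF //.
    by apply/imsetP=> -[i _ /eqP]; rewrite vx_eq.
  rewrite [X in _ || X]mem_imset; last exact: vx_inj.
  rewrite [X in X || _](_ : _ = false) //.
  by apply/imsetP=> -[i _ /eqP]; rewrite vx_eq.
pose E (A : {set 'I_N}) : S := if A == W a then 'X_[um true a] else 0.
pose kos := @koszul K N N id.
have [j0 j0ba] : exists j, j \in b :\: a.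
  by case/properP: ab => _ [j jb ja]; exists j; rewrite inE jb ja.
pose n := #|W a|.-1.
have cardW : #|W a| = n.+1.
  rewrite prednK // (cardD1 (vx true j0)) WE j0ba //.
have Zn (A : {set 'I_N}) : #|A| != n -> kos E A = 0.
  move=> An; rewrite /kos /koszul big1 // => i iA; rewrite /E.
  case: eqP => [Ei|]; last by rewrite mulr0.
  by case/eqP: An; apply: succn_inj; rewrite -cardW -Ei cardsU1 iA.
(* Up to sign, the nonzero coefficients are [x_j u_a = y_j u_(j |: a)]. *)
have ZH A : inHF F (kos E A).
  apply: inHF_sum => i iA; rewrite /E; case: eqP => [Ei|_]; last first.
    by rewrite mulr0 -[0](mul0r 'X_[um true (j0 |: a)]); apply/inHF_gen/ajF.
  have : i \in W a by rewrite -Ei setU11.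
  have [t [j ij]] := vxP i; rewrite ij WE setDv in_set0; case: t ij => // ij jba.
  rewrite -mulrA -mpolyXD addmC um_addx; last by move: jba; rewrite inE => /andP[].
  rewrite addmC mpolyXD mulrA; apply: inHF_gen; exact: ajF.
(* The ideal contains an element of degree [k]. Hence the coefficients of [kos E], of degree
   [k + 1], have no part of degree [d] and lift through [g] without constant terms. *)
have dk : (d <= k)%N.
  rewrite leqNgt; apply/negP => kd.
  have [/(_ (inHF_gen 1 (ajF _ j0ba)))[v]] := Hg (1 * 'X_[um true (j0 |: a)]).
  move/(congr1 (mcoeff (um true (j0 |: a)))); rewrite mul1r mcoeffX eqxx mxE raddf_sum.
  rewrite big1 => [/eqP|j _]; first by rewrite oner_eq0.
  rewrite /= (mcoeff_homogM _ (gd _)) ?mdeg_um 1?ltnW //.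
  by rewrite (dhomog_nemf_coeff (gd _)) ?mulr0 //= mdeg_um neq_ltn kd.
have Zd A m : mdeg m = d -> (kos E A)@_m = 0.
  move=> md; rewrite mcoeff_koszul big1 // => i /andP[iA mi]; rewrite /E.
  case: ifP => _; last by rewrite mcoeff0 mulr0.
  rewrite mcoeffX; case: eqP => [Em|]; last by rewrite mulr0.
  have := congr1 mdeg Em; rewrite mdeg_um => Ek.
  have := mdegD (m - U_(i)) U_(i); rewrite submK ?lem1E // md -Ek mdeg1 addn1 => Ed.
  by rewrite Ed ltnn in dk.
have /fin_all_exists[v vP] : forall A : {set 'I_N}, exists v : 'rV[S]_(bt 0%N),
    [/\ #|A| != n -> v = 0, forall l, (v 0 l)@_0 = 0 & (v *m g) 0 0 = kos E A].
  move=> A; case: (boolP (#|A| == n)) => An; last first.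
    exists 0; split=> // [l|]; first by rewrite mxE mcoeff0.
    by rewrite mul0mx mxE Zn.
  have [v vE] := (Hg _).1 (ZH A).
  have [|i m md|v' [v'E v'0]] := @lift_const_free _ _ _ _ g d v.
  - by move=> i j; rewrite ord1.
  - by rewrite ord1 -vE Zd.
  by exists v'; split; rewrite ?An // v'E.
have [A|A|A|y yd yv] := koszul_linear Dlin gex Dex (v := v) (i := n).
- by case: (vP A).
- by case: (vP A).
- apply/rowP=> i; rewrite ord1 !mxE -[RHS](koszul_koszul id E A).
  by apply: eq_bigr => j _; congr (_ * _); case: (vP (j |: A)).
pose Y A := (y A *m g) 0 0.
have YH A : inHF F (Y A) by apply/Hg; exists (y A).
pose E' A := E A - Y A.
have E'cyc A : kos E' A = 0.
  rewrite /kos koszulB; apply/eqP; rewrite subr_eq0; apply/eqP.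
  have := yv A; move/rowP/(_ 0); rewrite mxE => ->.
  by case: (vP A) => _ _ ->.
(* The coefficients of the cycle [E'] in the multidegree above; at [a] and [b], which are not in
   [F], those of [Y] vanish. *)
pose f q := (E' (W q))@_(um true q).
have fa : f a = 1.
  rewrite /f mcoeffB /E eqxx mcoeffX eqxx (inHF_coeff (YH _)) ?subr0 //.
  by move=> c cF; apply: contra aF => /um_le <-.
have fb : f b = 0.
  rewrite /f mcoeffB (inHF_coeff (YH _)) ?subr0 => [|c cF]; last first.
    by apply: contra bF => /um_le <-.
  rewrite /E; case: ifP => _; rewrite ?mcoeff0 // mcoeffX.
  case: eqP => // /um_inj Eab; by rewrite Eab properxx in ab.
(* Read at [x_j u_q = y_j u_(j |: q)], the cycle condition at [W q :\ vx true j] involves only [f q]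
   and [f (j |: q)]. *)
have step q j : a \subset q -> q \subset b -> j \in b :\: q -> f (j |: q) = 0 -> f q = 0.
  move=> aq qb; rewrite inE => /andP[jq jb] fj.
  have ja : j \notin a by apply: contra jq => /(subsetP aq).
  have jW : vx true j \in W q by rewrite WE inE jq jb.
  pose m := (um true q + U_(vx true j))%MM.
  have mE : (m - U_(vx false j) = um true (j |: q))%MM.
    by rewrite /m um_addx // addmK.
  have WE' : vx false j |: W q :\ vx true j = W (j |: q).
    apply/setP=> i; have [t [l ->]] := vxP i.
    rewrite in_setU1 in_setD1 !WE !vx_eq !inE; case: t => /=.
      by rewrite negb_or andbA.
    by case: (l =P j) => [->|] //=; rewrite ja.
  have := congr1 (mcoeff m) (E'cyc (W q :\ vx true j)).
  rewrite mcoeff0 mcoeff_koszul (bigD1 (vx true j)) /=; last first.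
    by rewrite !inE eqxx /= mnmDE mnm1E eqxx addn1.
  rewrite setD1K // addmK -/(f q) (bigD1 (vx false j)) /=; last first.
    rewrite in_setD1 WE !vx_eq /= inE (negbTE jq) andbF /=.
    by rewrite mnmDE umE (negbTE jq).
  rewrite mE WE' -/(f _) fj mulr0 add0r big1 ?addr0.
    by move/eqP; rewrite mulf_eq0 signr_eq0 => /eqP.
  move=> i /andP[/andP[/andP[_ mi] it] iF].
  have [t [l il]] := vxP i; move: mi it iF; rewrite il !vx_eq => mi it iF.
  have lj : l != j by move: it iF; case: (t); case: (l =P j).
  (* After division neither [x_l] nor [y_l] is left, while [u_c] contains one of them. *)
  have low c : ~~ (um true c <= m - U_(vx t l))%MM.
    apply/mnm_lepP => le; have := le (vx t l); have := le (vx (~~ t) l).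
    move: mi; rewrite /m !mnmBE !mnmDE !umE !mnm1E !vx_eq !eqxx [j == l]eq_sym.
    rewrite (negbTE lj) !andbF !addn0 /=.
    by case: (t); case: (l \in q); case: (l \in c).
  rewrite mcoeffB (inHF_coeff (YH _)) // subr0 /E.
  case: ifP => _; last by rewrite mcoeff0 mulr0.
  rewrite mcoeffX; case: eqP => [Em|]; last by rewrite mulr0.
  by have := low a; rewrite -Em => /mnm_lepP[].
have all0 c q : (#|b :\: q| < c)%N -> a \subset q -> q \subset b -> f q = 0.
  elim: c q => // c IHc q qc aq qb.
  have [q0|[j jbq]] := set_0Vmem (b :\: q).
    suff -> : q = b by [].
    by apply/eqP; rewrite eqEsubset qb /= -setD_eq0 q0.
  have jb : j \in b by move: jbq; rewrite inE => /andP[].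
  apply: (step q j) => //; apply: IHc.
  - move: qc; rewrite (cardsD1 j) jbq ltnS; apply: leq_trans.
    rewrite ltnS; apply: subset_leq_card; apply/subsetP=> l.
    by rewrite !inE negb_or => /andP[/andP[-> ->] ->].
  - by apply: subset_trans aq (subsetUr _ _).
  - by rewrite subUset sub1set jb.
have := all0 _ a (ltnSn _) (subxx _) (proper_sub ab).
by rewrite fa => /eqP; rewrite oner_eq0.
Qed.

End Obstruction.

(** * Birkhoff representation by down-sets of join-irreducibles *)

Section Birkhoff.
Local Open Scope order_scope.
Context {disp : Order.disp_t} {L : finTBDistrLatticeType disp}.
Implicit Types (p q r x y : L) (X : {set L}).
Local Notation V := 'I_(#|@JI _ L|).
Implicit Types (i j : V) (A D : {set V}).

Definition down x : {set L} := [set t | t <= x].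

(** A strictly monotone rank, used to pick maximal and minimal elements. *)
Lemma card_down_lt x y : x < y -> (#|down x| < #|down y|)%N.
Proof.
move=> xy; apply: proper_card; apply/properP; split.
  by apply/subsetP=> t; rewrite !inE => tx; apply: le_trans tx (ltW xy).
by exists y; rewrite !inE ?lexx // lt_geF.
Qed.

Lemma covers_between x p : x < p -> exists2 q, x <= q & covers p q.
Proof.
move=> xp; have P0 : (x <= x) && (x < p) by rewrite lexx.
case: (arg_maxnP (P := fun q => (x <= q) && (q < p)) (fun q => #|down q|) P0).
move=> q /andP[xq qp] qmax; exists q => //; rewrite /covers qp /=.
apply/forallP=> r; apply/negP => /andP[qr rp].
have /qmax : (x <= r) && (r < p) by rewrite rp (le_trans xq (ltW qr)).
by rewrite /= leqNgt card_down_lt.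
Qed.

Lemma covers_between_eq p q x : covers p q -> q <= x -> x <= p -> x = q \/ x = p.
Proof.
case/andP=> _ /forallP/(_ x); rewrite negb_and !lt_def => nx qx xp.
move: nx; rewrite qx xp !andbT !negbK => /orP[] /eqP; [left|right] => //.
Qed.

Lemma join_irr_lt p : join_irr p ->
  exists2 q, q < p & forall x, x < p -> x <= q.
Proof.
case/cards1P=> q Nq; have : q \in lower_nb p by rewrite Nq inE.
rewrite inE => /andP[qp _]; exists q => // x /covers_between[r xr pr].
have : r \in lower_nb p by rewrite inE.
by rewrite Nq inE => /eqP <-.
Qed.

(** Otherwise [p] meets both [q] and [r] below its unique lower neighbor, and by distributivity [p]
    itself lies below it. *)
Lemma join_irr_prime p q r : join_irr p -> p <= q `|` r -> (p <= q) || (p <= r).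
Proof.
case/join_irr_lt=> p' p'p lep' pqr; apply: contraT; rewrite negb_or => /andP[pq pr].
have lt y : ~~ (p <= y) -> p `&` y <= p'.
  move=> py; apply: lep'; rewrite lt_neqAle leIl andbT.
  by apply: contra py => /eqP<-; apply: leIr.
have := leU2 (lt q pq) (lt r pr); rewrite -meetUr joinxx.
by move/meet_idPl: pqr => ->; rewrite lt_geF.
Qed.

Lemma join_irr_bot p : join_irr p -> ~~ (p <= \bot).
Proof.
case/join_irr_lt=> q qp _; apply: contraL qp => /le_trans/(_ (le0x q)) pq.
by rewrite le_gtF.
Qed.

Lemma join_irr_prime_big (T : finType) (P : pred T) (f : T -> L) p :
  join_irr p -> p <= \join_(t | P t) f t -> exists2 t, P t & p <= f t.
Proof.
move=> pJ; elim/big_rec: _ => [|t x Pt IH]; first by rewrite (negbTE (join_irr_bot pJ)).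
by case/(join_irr_prime pJ)/orP => [|/IH//]; exists t.
Qed.

(** Take [p] minimal below [q] but not below [r]: two distinct lower neighbors would lie below [r]
    and have join [p]. *)
Lemma join_irr_sep q r : ~~ (q <= r) -> exists p, [/\ join_irr p, p <= q & ~~ (p <= r)].
Proof.
move=> qr; have P0 : (q <= q) && ~~ (q <= r) by rewrite lexx.
case: (arg_minnP (P := fun p => (p <= q) && ~~ (p <= r))
  (fun p => #|down p|) P0) => p /andP[pq pr] pmin.
have below x : x < p -> x <= r.
  move=> xp; apply: contraT => xr.
  have /pmin : (x <= q) && ~~ (x <= r) by rewrite xr (le_trans (ltW xp) pq).
  by rewrite leqNgt card_down_lt.
exists p; split=> //; have : \bot < p.
  by rewrite lt0x; apply: contra pr => /eqP->; apply: le0x.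
case/covers_between=> s _ ps; apply/cards1P; exists s.
apply/setP=> t; rewrite !inE; apply/idP/eqP => [pt|-> //].
have /andP[sp _] := ps; have /andP[tp _] := pt.
apply: contraNeq pr => ts; suff <- : s `|` t = p.
  by rewrite leUx !below.
have [//||//] := covers_between_eq ps (leUl s t); first by rewrite leUx !ltW.
move=> st; have [] := covers_between_eq pt _ (ltW sp); first by rewrite -st leUr.
  by move=> Est; rewrite Est eqxx in ts.
by move=> E; rewrite E ltxx in sp.
Qed.

(** The set of join-irreducibles below [q], indexed like the variables of the ring. *)
Definition phi q : {set V} := [set i | enum_val i <= q].

Lemma in_phi i q : (i \in phi q) = (enum_val i <= q).
Proof. by rewrite inE. Qed.

Lemma enum_val_ji i : join_irr (enum_val i).
Proof. by have := enum_valP i; rewrite inE. Qed.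

Lemma phi_sub q r : (phi q \subset phi r) = (q <= r).
Proof.
apply/idP/idP => [/subsetP sub|qr].
  apply: contraT => /join_irr_sep[p [pJ pq pr]].
  have pJI : p \in @JI _ L by rewrite inE.
  have := sub (enum_rank_in pJI p); rewrite !inE enum_rankK_in // pq => /(_ isT).
  by rewrite (negbTE pr).
by apply/subsetP=> i; rewrite !inE => iq; apply: le_trans iq qr.
Qed.

Lemma phi_inj : injective phi.
Proof.
by move=> q r /eqP; rewrite eqEsubset !phi_sub => /andP[qr rq]; apply/le_anti/andP.
Qed.

Lemma phi_proper q r : (phi q \proper phi r) = (q < r).
Proof. by rewrite properE !phi_sub lt_leAnge. Qed.

Lemma phiI q r : phi (q `&` r) = phi q :&: phi r.
Proof. by apply/setP=> i; rewrite !inE lexI. Qed.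

Lemma phiU q r : phi (q `|` r) = phi q :|: phi r.
Proof.
apply/setP=> i; rewrite !inE; apply/idP/orP => [/(join_irr_prime (enum_val_ji i))/orP//|].
by case=> h; apply: le_trans h _; [apply: leUl|apply: leUr].
Qed.

Definition psi D : L := \join_(i in D) enum_val i.

Lemma psiK D : (forall i j, i \in D -> enum_val j <= enum_val i -> j \in D) ->
  phi (psi D) = D.
Proof.
move=> Dd; apply/setP=> i; rewrite in_phi; apply/idP/idP => [|iD].
  by case/(join_irr_prime_big (enum_val_ji i)) => j jD; apply: Dd.
exact: (joins_min iD).
Qed.

Lemma phiK : cancel phi psi.
Proof.
move=> q; apply/phi_inj/psiK => i j; rewrite !in_phi => iq ji; exact: le_trans ji iq.
Qed.

Lemma phi_down q i j : i \in phi q -> enum_val j <= enum_val i -> j \in phi q.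
Proof. by rewrite !in_phi => iq ji; apply: le_trans ji iq. Qed.

Lemma enum_val_le_anti i j : enum_val i <= enum_val j -> enum_val j <= enum_val i -> i = j.
Proof. by move=> ij ji; apply: enum_val_inj; apply/le_anti/andP. Qed.

(** Take [j] maximal in the difference; it is then maximal in [phi r], because [phi q] is a
    down-set. *)
Lemma phi_setD1 q r : q < r ->
  exists2 j, j \in phi r :\: phi q & exists c, phi c = phi r :\ j.
Proof.
rewrite -phi_proper => /properP[_ [i0 i0r i0q]].
have P0 : i0 \in phi r :\: phi q by rewrite in_setD i0r i0q.
case: (arg_maxnP (P := mem (phi r :\: phi q))
  (fun i => #|down (enum_val i)|) P0) => j /= jD jmax.
exists j => //; exists (psi (phi r :\ j)); apply: psiK => i l.
rewrite in_setD1 => /andP[ij ir] li; rewrite in_setD1 (phi_down ir li) andbT.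
apply: contraNneq ij => lj; apply/eqP; rewrite lj in li.
have iD : i \in phi r :\: phi q.
  rewrite in_setD ir andbT; move: jD; rewrite in_setD => /andP[jq _].
  by apply: contra jq => iq; apply: phi_down iq li.
apply: enum_val_le_anti (li); have := jmax i iD; rewrite /= leqNgt; apply: contraNT => nij.
by apply: card_down_lt; rewrite lt_leAnge li nij.
Qed.

Lemma phi_setU1 q r : q < r ->
  exists2 j, j \in phi r :\: phi q & exists c, phi c = j |: phi q.
Proof.
rewrite -phi_proper => /properP[_ [i0 i0r i0q]].
have P0 : i0 \in phi r :\: phi q by rewrite in_setD i0r i0q.
case: (arg_minnP (P := mem (phi r :\: phi q))
  (fun i => #|down (enum_val i)|) P0) => j /= jD jmin.
exists j => //; exists (psi (j |: phi q)); apply: psiK => i l.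
rewrite !in_setU1 => /predU1P[->|iq] li; last by rewrite (phi_down iq li) orbT.
apply: contraT; rewrite negb_or => /andP[lj lq].
have lD : l \in phi r :\: phi q.
  rewrite in_setD lq /=; move: jD; rewrite in_setD => /andP[_ jr].
  exact: phi_down jr li.
have := jmin l lD; rewrite leqNgt => /negP[]; apply: card_down_lt.
rewrite lt_neqAle li andbT; apply: contra lj => /eqP/enum_val_inj->; exact: eqxx.
Qed.

(** [phi_setU1] gives an element above [q], at most [p], with one more join-irreducible; it must be
    [p]. *)
Lemma coversP p q :
  reflect (exists2 j, j \notin phi q & phi p = j |: phi q) (covers p q).
Proof.
apply: (iffP idP) => [pq|[j jq pE]].
  have /andP[qp _] := pq; have [j jD [c cE]] := phi_setU1 qp; move: jD.
  rewrite in_setD => /andP[jq jp]; exists j => //; rewrite -cE; congr phi.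
  have [||//|//] := covers_between_eq pq (x := c).
  - by rewrite -phi_sub cE subsetUr.
  - by rewrite -phi_sub cE subUset sub1set jp phi_sub ltW.
  by move=> Ec; move: jq; rewrite -Ec cE setU11.
have qp : q < p by rewrite -phi_proper pE properE subsetUr subUset sub1set (negbTE jq).
rewrite /covers qp; apply/forallP=> r; apply/negP; rewrite -!phi_proper => /andP[qr rp].
have := proper_card qr; have := proper_card rp; rewrite pE cardsU1 jq add1n.
by move=> h1 h2; have := leq_trans h1 h2; rewrite ltnn.
Qed.

End Birkhoff.

(** * Ideals and coideals of the lattice *)

Section HibiIdeals.
Local Open Scope order_scope.
Context (K : fieldType) {disp : Order.disp_t} {L : finTBDistrLatticeType disp}.
Implicit Types (p q r x y : L) (X I J : {set L}).
Local Notation n := #|@JI _ L|.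
Local Notation V := 'I_n.
Local Notation S := {mpoly K[(n + n)%N]}.
Implicit Types (a A B : {set V}).

Definition fam X : {set {set V}} := [set phi q | q in X].

Lemma in_fam X q : (phi q \in fam X) = (q \in X).
Proof. by rewrite mem_imset //; apply: phi_inj. Qed.

Lemma famP X a : reflect (exists2 q, q \in X & a = phi q) (a \in fam X).
Proof. exact: imsetP. Qed.

Lemma famI X X' : fam (X :&: X') = fam X :&: fam X'.
Proof. by apply: imsetI => ? ? _ _; apply: phi_inj. Qed.

Lemma famU X X' : fam (X :|: X') = fam X :|: fam X'.
Proof. exact: imsetU. Qed.

Lemma index_enum_val (i : V) : index (enum_val i) (enum (@JI _ L)) = i.
Proof. by rewrite /enum_val index_uniq ?enum_uniq // -cardE. Qed.

Lemma u_monE q : u_mon K q = 'X_[um true (phi q)].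
Proof.
have varE (i : 'I_(n + n)) : @var K _ L i = 'X_i by rewrite /var valK.
have xvE (i : V) : xv K (enum_val i) = 'X_(vx true i).
  by rewrite /xv index_enum_val -varE.
have yvE (i : V) : yv K (enum_val i) = 'X_(vx false i).
  by rewrite /yv index_enum_val -varE.
rewrite /u_mon mpolyXE_id big_split_ord /= !big_enum_val_cond.
congr (_ * _)%R; rewrite big_mkcond; apply: eq_bigr => i _.
  by rewrite xvE -[lshift n i]/(vx true i) umE in_phi; case: (_ <= _).
by rewrite yvE -[rshift n i]/(vx false i) umE in_phi; case: (_ <= _).
Qed.

Lemma inHE X (f : S) : inH X f <-> inHF (fam X) f.
Proof.
have sumE (c : {set V} -> S) :
    (\sum_(a in fam X) c a * 'X_[um true a] = \sum_(q in X) c (phi q) * u_mon K q)%R.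
  rewrite big_imset /=; last by move=> ? ? _ _; apply: phi_inj.
  by apply: eq_bigr => q _; rewrite u_monE.
split=> [[c ->]|[c ->]]; last by exists (c \o phi); rewrite sumE.
exists (c \o psi); rewrite sumE; apply: eq_bigr => q _ /=.
by rewrite phiK.
Qed.

Lemma eq_linear_resolution m (P Q : {mpoly K[m]} -> Prop) :
  (forall f, P f <-> Q f) -> has_linear_resolution P -> has_linear_resolution Q.
Proof.
move=> PQ [d [b [g [D [gd Dl Pg gex Dex]]]]]; exists d, b, g, D; split=> // f.
by rewrite -PQ.
Qed.

Variables (I J : {set L}).
Hypotheses (Iid : poset_ideal I) (Jco : poset_coideal J) (IJ : I :|: J = [set: L]).

Lemma notJ_I x : x \notin J -> x \in I.
Proof. by move=> xJ; have := in_setT x; rewrite -IJ inE (negbTE xJ) orbF. Qed.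

(** A cube lies in an ideal once its top [p] does, and in a coideal once its bottom [r] does. *)
Lemma cell_idealP a A : cell (fam [set: L]) a A ->
  exists p r, [/\ a = phi r, a :|: A = phi p,
    p \in I -> cell (fam I) a A & r \in J -> cell (fam J) a A].
Proof.
move=> c; have /famP[p _ pE] := cell_top c; have /famP[r _ rE] := cell_bot c.
exists p, r; split=> //; case/cellP: c => dis H.
  move=> pI; apply/cellP; split=> // B BA; have /famP[x _ xE] := H B BA.
  rewrite xE in_fam; apply: Iid pI _; rewrite -phi_sub -xE -pE; exact: setUS.
move=> rJ; apply/cellP; split=> // B BA; have /famP[x _ xE] := H B BA.
by rewrite xE in_fam; apply: Jco rJ _; rewrite -phi_sub -xE -rE subsetUl.
Qed.

(** Dropping any [j] in [A] from the top gives a lower neighbor of [p], so [phi (meetN p)] misses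
    [A]. *)
Lemma cell_meetN p r A : cell (fam [set: L]) (phi r) A -> phi r :|: A = phi p ->
  A != set0 -> meetN p <= r.
Proof.
move=> /cellP[dis H] pE /set0Pn[j0 j0A].
have face j : j \in A -> exists2 q, phi q = phi p :\ j & q \in lower_nb p.
  move=> jA; have /famP[q _ qE] := H (A :\ j) (subsetDl _ _).
  have jr : j \notin phi r.
    by apply/negP => jr; have /pred0P/(_ j) := dis; rewrite /= jr jA.
  have {}qE : phi q = phi p :\ j.
    rewrite -qE -pE setDUl; congr (_ :|: _); apply/setP=> l; rewrite in_setD1.
    by case: (l =P j) => [->|] //=; rewrite (negbTE jr).
  exists q => //; rewrite inE; apply/coversP; exists j; rewrite qE ?setD11 // setD1K //.
  by rewrite -pE inE jA orbT.
have [q0 q0E q0N] := face j0 j0A.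
rewrite -phi_sub; apply/subsetP=> l lm.
have : l \in phi p.
  apply: (subsetP _ l lm); rewrite phi_sub (le_trans (meets_inf _ q0N)) //.
  by rewrite -phi_sub q0E subsetDl.
rewrite -pE inE => /orP[//|lA]; have [q qE qN] := face l lA.
have : l \in phi q by apply: (subsetP _ l lm); rewrite phi_sub; apply: meets_inf.
by rewrite qE setD11.
Qed.

Lemma cell_joinM p r A : cell (fam [set: L]) (phi r) A -> phi r :|: A = phi p ->
  A != set0 -> p <= joinM r.
Proof.
move=> /cellP[dis H] pE /set0Pn[j0 j0A].
have face j : j \in A -> exists2 q, phi q = j |: phi r & q \in upper_nb r.
  move=> jA; have := H [set j]; rewrite sub1set => /(_ jA)/famP[q _ qE].
  have jr : j \notin phi r.
    by apply/negP => jr; have /pred0P/(_ j) := dis; rewrite /= jr jA.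
  exists q; first by rewrite -qE setUC.
  by rewrite inE; apply/coversP; exists j; rewrite // -qE setUC.
have up j : j \in A -> j |: phi r \subset phi (joinM r).
  by move=> /face[q <- qN]; rewrite phi_sub; apply: joins_sup.
rewrite -phi_sub -pE; apply/subsetP=> l; rewrite inE => /orP[lr|lA].
  by apply: (subsetP (up j0 j0A)); rewrite in_setU1 lr orbT.
by apply: (subsetP (up l lA)); rewrite setU11.
Qed.

Definition cells_split :=
  forall a A, cell (fam [set: L]) a A -> cell (fam I) a A || cell (fam J) a A.

Lemma meetN_cells_split : (forall p, p \in I \/ meetN p \in J) -> cells_split.
Proof.
move=> H a A c; have [p [r [aE pE cI cJ]]] := cell_idealP c.
(* Vertices are covered by [I :|: J] directly, since [cell_meetN] concerns positive dimension. *)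
have [A0|A0] := eqVneq A set0.
  have : a \in fam [set: L] by rewrite aE in_fam inE.
  by rewrite A0 !cell0 -IJ famU inE.
have [/cI -> //|mJ] := H p; apply/orP; right; apply: cJ; apply: Jco mJ _.
by apply: (cell_meetN (A := A)) => //; rewrite -aE.
Qed.

Lemma joinM_cells_split : (forall r, r \in J \/ joinM r \in I) -> cells_split.
Proof.
move=> H a A c; have [p [r [aE pE cI cJ]]] := cell_idealP c.
have [A0|A0] := eqVneq A set0.
  have : a \in fam [set: L] by rewrite aE in_fam inE.
  by rewrite A0 !cell0 -IJ famU inE.
have [/cJ ->|mI] := H r; first exact: orbT.
apply/orP; left; apply: cI; apply: Iid mI _.
by apply: (cell_joinM (A := A)) => //; rewrite -aE.
Qed.

(** The interval from [r] to [joinM r] is a cube: each join-irreducible it adds comes from one upper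
    neighbor and is minimal outside [phi r]. *)
Lemma cells_split_joinM : cells_split -> forall r, r \in J \/ joinM r \in I.
Proof.
move=> H r; have [U0|[s0 s0U]] := set_0Vmem (upper_nb r).
  rewrite /joinM U0 big_set0; case: (boolP (r \in J)) => rJ; [by left|right].
  by apply: Iid (notJ_I rJ) (le0x r).
have rs : r <= joinM r.
  apply: le_trans (joins_sup _ s0U); move: s0U; rewrite inE => /andP[/ltW//].
pose A := phi (joinM r) :\: phi r.
have rA : phi r :|: A = phi (joinM r).
  by rewrite /A setDE setUIr setUCr setIT; apply/setUidPr; rewrite phi_sub.
have c : cell (fam [set: L]) (phi r) A.
  apply/cellP; split=> [|B BA].
    by apply/pred0P => l; rewrite /= in_setD; case: (l \in phi r).
  suff <- : phi (psi (phi r :|: B)) = phi r :|: B by rewrite in_fam inE.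
  apply: psiK => i j; rewrite !in_setU => /orP[ir|iB] ji.
    by rewrite (phi_down ir ji).
  have /andP[ir] : (i \notin phi r) && (i \in phi (joinM r)).
    by rewrite -in_setD (subsetP BA).
  rewrite [i \in _]in_phi => /(join_irr_prime_big (enum_val_ji i))[s sU].
  rewrite -in_phi => is_; move: sU; rewrite inE => /coversP[l lr sE].
  have li : l = i by move: is_; rewrite sE in_setU1 (negbTE ir) orbF => /eqP.
  have := phi_down is_ ji; rewrite sE li in_setU1 => /predU1P[->|->//].
  by rewrite iB orbT.
case/orP: (H _ _ c) => [/cell_top|/cell_bot]; rewrite ?rA in_fam; by [right|left].
Qed.

Lemma cells_split_linear : cells_split ->
  has_linear_resolution (inHF (K := K) (fam (I :&: J))).
Proof.
move=> H; rewrite famI; apply: cube_linear_resolution => i z.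
have IJT : fam I :|: fam J = fam [set: L] by rewrite -famU IJ.
apply: capcube_exact; rewrite ?IJT //.
- by move=> _ _ /famP[p _ ->] /famP[q _ ->]; rewrite -phiI in_fam inE.
- move=> _ _ /famP[p _ ->] /famP[q _ ->]; rewrite phi_proper => /phi_setD1[j jD [c cE]].
  by exists j; rewrite // -cE in_fam inE.
- move=> _ _ /famP[p pI ->] /famP[q _ ->]; rewrite -phiI in_fam.
  by apply: Iid pI _; apply: leIl.
- move=> _ _ /famP[p _ ->] /famP[q qI ->]; rewrite phi_proper => /phi_setD1[j jD [c cE]].
  exists j; rewrite // -cE in_fam; apply: Iid qI _.
  by rewrite -phi_sub cE subsetDl.
- move=> _ _ /famP[p pJ ->] /famP[q _ ->]; rewrite -phiU in_fam.
  by apply: Jco pJ _; apply: leUl.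
move=> _ _ /famP[p pJ ->] /famP[q _ ->]; rewrite phi_proper => /phi_setU1[j jD [c cE]].
exists j; rewrite // -cE in_fam; apply: Jco pJ _.
by rewrite -phi_sub cE subsetUr.
Qed.

Hypothesis HIJ : forall f : Sring K L, inH (I :&: J) f <-> inH I f /\ inH J f.

(** Otherwise [x_j u_q = y_j u_p] lies in both ideals, while the only generators dividing it, [u_q]
    and [u_p], do not come from [I :&: J]. *)
Lemma covers_split p q : covers p q -> q \in J \/ p \in I.
Proof.
case/coversP=> j jq pE.
case: (boolP (q \in J)) => [|qJ]; [by left|right]; apply: contraT => pI.
have pJ : p \in J by apply: contraR pI; apply: notJ_I.
pose m := (um true (phi q) + U_(vx true j))%MM.
have /HIJ/inHE/inHF_coeff H : inH I ('X_[m] : S) /\ inH J ('X_[m] : S).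
  split; apply/inHE.
    by rewrite /m addmC mpolyXD; apply: inHF_gen; rewrite in_fam notJ_I.
  by rewrite /m (um_addx true jq) -pE addmC mpolyXD; apply: inHF_gen; rewrite in_fam.
suff /H : {in fam (I :&: J), forall a, ~~ (um true a <= m)%MM}.
  by rewrite mcoeffX eqxx => /eqP; rewrite oner_eq0.
move=> _ /famP[s /setIP[sI sJ] ->]; apply/negP => /um_le_add sq.
have [js|js] := boolP (j \in phi s).
  suff /phi_inj sp : phi s = phi p by rewrite -sp sI in pI.
  apply/setP=> i; rewrite pE in_setU1; case: (i =P j) => [->//|/eqP ij].
  by rewrite sq.
suff /phi_inj sp : phi s = phi q by rewrite -sp sJ in qJ.
apply/setP=> i; case: (i =P j) => [->|/eqP ij]; last by rewrite sq.
by rewrite (negbTE js) (negbTE jq).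
Qed.

Lemma linear_meetN : has_linear_resolution (inHF (K := K) (fam (I :&: J))) ->
  forall p, p \in I \/ meetN p \in J.
Proof.
move=> lin p; case: (boolP (p \in I)) => [|pI]; [by left|right].
apply: contraT => mJ.
have pJ : p \in J by apply: contraR pI; apply: notJ_I.
have [N0|[q0 q0N]] := set_0Vmem (lower_nb p).
  by move: mJ; rewrite /meetN N0 big_set0 (Jco pJ (lex1 p)).
have mp : meetN p <= p.
  apply: le_trans (meets_inf _ q0N) _; move: q0N; rewrite inE => /andP[/ltW//].
have P0 : [&& meetN p <= meetN p, meetN p <= p & meetN p \notin J] by rewrite lexx mp.
case: (arg_maxnP (P := fun x => [&& meetN p <= x, x <= p & x \notin J])
  (fun x => #|phi x|) P0) => a /and3P[ma ap aJ] amax.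
have ltap : a < p.
  by rewrite lt_neqAle ap andbT; apply: contraNneq aJ => ->.
case: (linear_resolution_obstruction (a := phi a) (b := phi p) lin).
- by rewrite phi_proper.
- by rewrite in_fam inE (negbTE aJ) andbF.
- by rewrite in_fam inE (negbTE pI).
move=> j; rewrite in_setD => /andP[ja jp].
(* An [l] strictly below [j] lies in every lower neighbor of [p]: each omits just one element of
   [phi p], and omitting [l] would force omitting [j]. So [l] is below [meetN p], hence below
   [a]. *)
have cE : phi (psi (j |: phi a)) = j |: phi a.
  apply: psiK => i l; rewrite !in_setU1 => /predU1P[->|ia] lj; last first.
    by rewrite (phi_down ia lj) orbT.
  case: (l =P j) => //= /eqP nlj; apply: (subsetP _ l (_ : l \in phi (meetN p))).
    by rewrite phi_sub.
  rewrite in_phi; apply/meetsP => q qN; rewrite -in_phi; apply: contraT => lq.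
  move: qN; rewrite inE => /coversP[i' i'q pE].
  have lp := phi_down jp lj; move: lp jp; rewrite pE !in_setU1 (negbTE lq) orbF.
  move=> /eqP <-; rewrite eq_sym (negbTE nlj) /= => jq.
  by rewrite (phi_down jq lj) in lq.
rewrite -cE in_fam inE; set c := psi _ in cE *.
have ac : covers c a by apply/coversP; exists j.
have cp : c <= p by rewrite -phi_sub cE subUset sub1set jp phi_sub.
(* [c] is in [I] because [a] is not in [J], and in [J] by the maximality of [a]. *)
have [aJ'|-> /=] := covers_split ac; first by rewrite aJ' in aJ.
apply: contraT => cJ.
have /amax : [&& meetN p <= c, c <= p & c \notin J].
  by case/andP: ac => /ltW ac _; rewrite cJ cp (le_trans ma ac).
by rewrite /= cE cardsU1 ja ltnn.
Qed.

End HibiIdeals.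

Local Open Scope order_scope.

Theorem theorem3p9 (K : fieldType) (disp : Order.disp_t)
    (L : finTBDistrLatticeType disp) (I J : {set L}) :
  poset_ideal I -> poset_coideal J -> I :|: J = [set: L] ->
  (forall f : Sring K L, inH (I :&: J) f <-> inH I f /\ inH J f) ->
  [<-> has_linear_resolution (fun f : Sring K L => inH I f /\ inH J f);
       forall p : L, p \in I \/ meetN p \in J;
       forall r : L, r \in J \/ joinM r \in I].
Proof.
move=> Iid Jco IJ HIJ.
have HF (f : Sring K L) : inH I f /\ inH J f <-> inHF (fam (I :&: J)) f.
  by rewrite -HIJ; apply: inHE.
tfae.
- by move/(eq_linear_resolution HF); apply: linear_meetN.
- by move/(meetN_cells_split Iid Jco IJ); apply: cells_split_joinM.
move/(joinM_cells_split Iid Jco IJ)/(cells_split_linear K Iid Jco IJ).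
by apply: eq_linear_resolution => f; rewrite HF.
Qed.
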